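(* Let $V=\mathrm{span}(\mathbf{v}_1,\dots,\mathbf{v}_d)\subset\mathbb{R}^k$ be a $d$-dimensional subspace which is Diophantine. Then there are constants $C>0$ and $\delta>0$ such that for every $\mathbf{x}\in\mathbb{R}^k$, every $T>1$ and every aligned box $U\subset\mathbb{T}^k$, $$\big|N_T(U,\mathbf{x})-|U|\,|B_T|\big|\le C\,T^{d-\delta}.$$
   Context: $\mathbb{T}^k=\mathbb{R}^k/\mathbb{Z}^k$ and $\pi:\mathbb{R}^k\to\mathbb{T}^k$ is the canonical projection. $\mathbf{v}_1,\dots,\mathbf{v}_d$ is a fixed basis of $V$, $1\le d<k$, and for $T>0$, $B_T=\{\sum_{i=1}^d a_i\mathbf{v}_i:\max_i|a_i|\le T\}$. $|\cdot|$ denotes Lebesgue measure (on $\mathbb{T}^k$ for $U$, and on $V$ for $B_T$), and $N_T(U,\mathbf{x})=\int_{B_T}\chi_U(\pi(\mathbf{x}+\mathbf{t}))\,d\mathbf{t}$, the integral being with respect to the same Lebesgue measure on $V$. $\|\mathbf{m}\|$ is the sup-norm. A vector $\mathbf{v}\in\mathbb{R}^k$ is Diophantine if there are constants $c,s>0$ with $|\mathbf{m}\cdot\mathbf{v}|\ge c\|\mathbf{m}\|^{-s}$ for all nonzero $\mathbf{m}\in\mathbb{Z}^k$. A subspace $V$ is Diophantine if it contains a Diophantine vector. An aligned box in $\mathbb{T}^k$ is the image under $\pi$ of a set $[a_1,b_1]\times\cdots\times[a_k,b_k]$ with $b_i-a_i<1$ for all $i$. *)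

(* Defs.v *)
From HB Require Import structures.
From mathcomp Require Import all_boot all_order all_algebra.
From mathcomp Require Import all_classical all_reals all_analysis.
From mathcomp Require Import measurable_realfun.

Set Implicit Arguments.
Unset Strict Implicit.
Unset Printing Implicit Defensive.

Import Order.TTheory GRing.Theory Num.Theory.
Import numFieldNormedType.Exports.

Local Open Scope classical_set_scope.
Local Open Scope ring_scope.

Definition measure_rV_display : measure_display.
Proof. exact: default_measure_display. Qed.

(* The product (equivalently, Borel) sigma-algebra on R^n, as the library
   does for n-tuples. *)
Section measurable_rV.
Context {R : realType} {n : nat}.

Let coord (i : 'I_n) (x : 'rV[R]_n) : measurableTypeR R := x 0 i.

Let rV_set0 : g_sigma_preimage coord set0.
Proof. exact: sigma_algebra0. Qed.

Let rV_setC A : g_sigma_preimage coord A -> g_sigma_preimage coord (~` A).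
Proof. exact: sigma_algebraC. Qed.

Let rV_bigcup (F : (set 'rV[R]_n)^nat) :
  (forall i, g_sigma_preimage coord (F i)) ->
  g_sigma_preimage coord (\bigcup_i (F i)).
Proof. exact: sigma_algebra_bigcup. Qed.

HB.instance Definition _ := @isMeasurable.Build
  measure_rV_display
  'rV[R]_n (g_sigma_preimage coord) rV_set0 rV_setC rV_bigcup.

Lemma measurable_coord (i : 'I_n) :
  measurable_fun [set: 'rV[R]_n] (fun x => x 0 i : measurableTypeR R).
Proof.
move=> _ Y mY; rewrite setTI; apply: sub_sigma_algebra => /=.
rewrite -bigcup_seq/=; exists i => /=; first by rewrite mem_index_enum.
by exists Y => //; rewrite setTI.
Qed.

Lemma measurable_fun_coordP d (T : measurableType d) (f : T -> 'rV[R]_n) :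
  (forall i, measurable_fun [set: T] (fun t => f t 0 i : measurableTypeR R)) ->
  measurable_fun [set: T] f.
Proof.
move=> mf; apply: (@measurability _ _ _ _ setT f
  (\big[setU/set0]_(i < n) preimage_set_system setT (coord i) measurable)) => //.
move=> _ [B + <-]; rewrite -bigcup_seq => -[i _ [C mC <-]].
by rewrite setTI; exact: mf.
Qed.

End measurable_rV.

Section lebesgue_rV.
Context {R : realType}.

Definition cons_rV n (p : measurableTypeR R * 'rV[R]_n) : 'rV[R]_n.+1 :=
  row_mx (p.1 : R)%:M p.2.

Lemma cons_rV0 n p : @cons_rV n p 0 ord0 = p.1.
Proof.
by rewrite /cons_rV mxE; case: splitP => // j _; rewrite ord1 mxE eqxx.
Qed.

Lemma cons_rVS n p (i : 'I_n) : @cons_rV n p 0 (lift ord0 i) = p.2 0 i.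
Proof.
rewrite /cons_rV mxE; case: splitP => [j|j /= [ij]]; first by rewrite ord1.
by congr (p.2 0 _); exact: val_inj.
Qed.

Lemma measurable_cons_rV n : measurable_fun setT (@cons_rV n).
Proof.
apply: measurable_fun_coordP => i; case: (unliftP ord0 i) => [j|] ->.
  under eq_fun do rewrite cons_rVS.
  exact: measurableT_comp (measurable_coord j) measurable_snd.
by under eq_fun do rewrite cons_rV0; exact: measurable_fst.
Qed.

Section cons.
Variables (n : nat) (mu : {sigma_finite_measure set 'rV[R]_n -> \bar R}).

Definition lebesgue_cons : set 'rV[R]_n.+1 -> \bar R :=
  pushforward (@lebesgue_measure R \x mu)%E (@cons_rV n).

Let pm := measure_function_pushforward__canonical__measure_function_Measure
  (@lebesgue_measure R \x mu)%E (@measurable_cons_rV n).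

HB.instance Definition _ := isMeasure.Build _ _ _ lebesgue_cons
  (measure0 pm) (measure_ge0 pm) (@measure_semi_sigma_additive _ _ _ pm).

Let lebesgue_cons_sigma_finite : sigma_finite setT lebesgue_cons.
Proof.
have /sigma_finiteP[F [FT ndF mF]] := @sigma_finiteT _ _ _ (@lebesgue_measure R).
have /sigma_finiteP[G [GT ndG mG]] := @sigma_finiteT _ _ _ mu.
exists (fun i => [set x : 'rV[R]_n.+1 |
    F i (x 0 ord0) /\ G i (\row_j x 0 (lift ord0 j))]).
  apply/seteqP; split => // x _.
  have [i _ Fi] : (\bigcup_i F i) (x 0 ord0) by rewrite -FT.
  have [j _ Gj] : (\bigcup_i G i) (\row_j x 0 (lift ord0 j)) by rewrite -GT.
  exists (maxn i j) => //; split.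
    by move: Fi; apply/subsetPset/ndF/leq_maxl.
  by move: Gj; apply/subsetPset/ndG/leq_maxr.
move=> i; have [mFi Fioo] := mF i; have [mGi Gioo] := mG i; split.
  apply: measurableI.
    by rewrite -[X in measurable X]setTI; exact: measurable_coord.
  rewrite -[X in measurable X]setTI.
  suff mtl : measurable_fun setT
      (fun x : 'rV[R]_n.+1 => \row_j x 0 (lift ord0 j) : 'rV[R]_n) by exact: mtl.
  apply: measurable_fun_coordP => j; under eq_fun do rewrite mxE.
  exact: measurable_coord.
rewrite /lebesgue_cons /pushforward [X in (_ \x _)%E X](_ : _ = F i `*` G i).
  by rewrite product_measure1E// lte_mul_pinfty// ge0_fin_numE.
apply/seteqP; split => -[a b] /=; rewrite cons_rV0 => -[Fa];
  by rewrite (_ : \row_j _ = b)//; apply/rowP => j; rewrite mxE cons_rVS.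
Qed.

HB.instance Definition _ := @Measure_isSigmaFinite.Build _ _ _ lebesgue_cons
  lebesgue_cons_sigma_finite.

End cons.

Fixpoint lebesgue_rV n : {sigma_finite_measure set 'rV[R]_n -> \bar R} :=
  match n with
  | 0 => \d_(0 : 'rV[R]_0)
  | m.+1 => lebesgue_cons (lebesgue_rV m)
  end.

End lebesgue_rV.

Section torus.
Variables (R : realType) (k : nat).

Definition int_lattice : {pred 'rV[R]_k} :=
  fun x => [forall i, x 0 i \is a Num.int].

Fact int_lattice_zmod_closed : zmod_closed int_lattice.
Proof.
split=> [|x y /forallP xZ /forallP yZ]; apply/forallP => i; rewrite !mxE//.
by rewrite rpredB.
Qed.
HB.instance Definition _ :=
  GRing.isZmodClosed.Build 'rV[R]_k int_lattice int_lattice_zmod_closed.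

Definition torus : Type := Quotient.quot int_lattice.

Definition torus_pi (x : 'rV[R]_k) : torus := \pi_(Quotient.quot int_lattice)%qT x.

(* [0, 1[^k is a fundamental domain for the lattice. *)
Definition torus_lebesgue (U : set torus) : \bar R :=
  lebesgue_rV k (torus_pi @^-1` U `&` [set x : 'rV[R]_k | forall i, 0 <= x 0 i < 1]).

Definition aligned_box (U : set torus) : Prop :=
  exists a b : 'rV[R]_k, (forall i, b 0 i - a 0 i < 1) /\
    U = torus_pi @` [set x : 'rV[R]_k | forall i, a 0 i <= x 0 i <= b 0 i].

Definition dotrV (x y : 'rV[R]_k) : R := \sum_i x 0 i * y 0 i.

(* `|m| is the sup-norm on row vectors. *)
Definition diophantine (v : 'rV[R]_k) : Prop :=
  exists c s : R, [/\ 0 < c, 0 < s &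
    forall m, m \in int_lattice -> m != 0 ->
      c * `|m| `^ (- s) <= `|dotrV m v|].

Definition diophantine_subspace (V : {vspace 'rV[R]_k}) : Prop :=
  exists2 v, v \in V & diophantine v.

End torus.

Section span_measure.
Variables (R : realType) (k d : nat) (v : d.-tuple 'rV[R]_k).

Definition lincomb (a : 'rV[R]_d) : 'rV[R]_k := \sum_i a 0 i *: tnth v i.

Lemma measurable_lincomb : measurable_fun setT lincomb.
Proof.
apply: measurable_fun_coordP => i; rewrite /lincomb.
under eq_fun do rewrite summxE.
under eq_fun do under eq_bigr do rewrite mxE.
apply: measurable_sum => j; apply: measurable_funM; last exact: measurable_cst.
exact: measurable_coord.
Qed.

Definition gram : 'M[R]_d := \matrix_(i, j) dotrV (tnth v i) (tnth v j).

(* For v linearly independent, the d-dimensional (Euclidean) Lebesgue measure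
   on the span of v, seen as a measure on R^k: by the area formula, it is the
   image of the Lebesgue measure on R^d under the parametrization lincomb,
   scaled by its Jacobian sqrt (det (gram v)). It only depends on the span,
   and lincomb is an isometry when v is orthonormal (gram v = 1). *)
Definition span_lebesgue : set 'rV[R]_k -> \bar R :=
  fun A => ((Num.sqrt (\det gram))%:E * pushforward (lebesgue_rV d) lincomb A)%E.

Let pm := mscale (Num.sqrt (\det gram))%:nng
  (measure_function_pushforward__canonical__measure_function_Measure
     (lebesgue_rV d) measurable_lincomb).

HB.instance Definition _ := isMeasure.Build _ _ _ span_lebesgue
  (measure0 pm) (measure_ge0 pm) (@measure_semi_sigma_additive _ _ _ pm).

Definition span_box (T : R) : set 'rV[R]_k :=
  lincomb @` [set a : 'rV[R]_d | forall i, `|a 0 i| <= T].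

Definition visits (U : set (torus R k)) (x : 'rV[R]_k) (T : R) : \bar R :=
  (\int[span_lebesgue]_(t in span_box T) (\1_U (torus_pi (x + t)))%:E)%E.

End span_measure.

(* Main.v *)
Require Import Defs.
From HB Require Import structures.
From mathcomp Require Import all_boot all_order all_algebra.
From mathcomp Require Import all_classical all_reals all_analysis.
From mathcomp Require Import measurable_realfun.
From mathcomp Require Import ring lra zify.

Set Implicit Arguments.
Unset Strict Implicit.
Unset Printing Implicit Defensive.

Import Order.TTheory GRing.Theory Num.Theory.
Import numFieldNormedType.Exports.

Local Open Scope classical_set_scope.
Local Open Scope ring_scope.

(** Let K be the k-dimensional Fejer kernel of order N: it is nonnegative, has
    integral 1 over the torus, and its second moment is O(1/N). If p lies in A
    and A, enlarged by e in every direction modulo Z^k, is contained in B, then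
    Chebyshev's inequality gives
      1_A(p) <= int_{[0,1[^k} 1_B(z) K(z - p) dz + O(1/(N e^2)).
    Put p = x + t and integrate over t in B_T. Each nonconstant frequency m of K
    contributes O(T^(d-1) / max_i |m.v_i|) = O(T^(d-1) N^s), because a
    Diophantine vector of V is a combination of the v_i; so the time average of
    1_A is at most |B| + O(1/(N e^2) + N^(k+s)/T). Taking for (A, B) a box and
    its enlargement, and then the complements of the box and of a smaller one,
    gives both bounds, with N a small power of T and e a small negative one. *)

(** * Lebesgue measure of boxes *)

Section rV_box.
Context {R : realType}.

Definition rV_box n (D : 'I_n -> set R) : set 'rV[R]_n :=
  [set x | forall i, D i (x 0 i)].

Lemma measurable_rV_box n (D : 'I_n -> set R) :
  (forall i, measurable (D i : set (measurableTypeR R))) -> measurable (rV_box D).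
Proof.
move=> mD; rewrite (_ : rV_box D =
    \bigcap_(i in [set: 'I_n]) ((fun x : 'rV[R]_n => x 0 i) @^-1` D i)); last first.
  by apply/seteqP; split => x xD; [move=> i _; exact: xD|move=> i; exact: xD].
apply: fin_bigcap_measurable => [|i _]; first exact: finite_finset.
by rewrite -[X in measurable X]setTI; exact: measurable_coord.
Qed.

Lemma cons_rV_box n (D : 'I_n.+1 -> set R) :
  @cons_rV R n @^-1` rV_box D = D ord0 `*` rV_box (D \o lift ord0).
Proof.
apply/seteqP; split => [[a y] xD|[a y] [/= Da Dy] i].
  split => [|i] /=; first by have := xD ord0; rewrite cons_rV0.
  by have := xD (lift ord0 i); rewrite cons_rVS.
by case: (unliftP ord0 i) => [j|] ->; rewrite ?cons_rVS ?cons_rV0//; exact: Dy.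
Qed.

(** Induction on [n]: along [cons_rV] a box pulls back to its first side times a box of lower
    dimension. The side lengths are given as reals, so that the product is formed in [R]. *)
Lemma lebesgue_rV_box n (D : 'I_n -> set R) (r : 'I_n -> R) :
  (forall i, measurable (D i : set (measurableTypeR R))) ->
  (forall i, lebesgue_measure (D i) = (r i)%:E) ->
  lebesgue_rV n (rV_box D) = (\prod_i r i)%:E.
Proof.
elim: n D r => [|n IH] D r mD rD.
  by rewrite big_ord0 /= diracE mem_set// => -[].
rewrite big_ord_recl /= /lebesgue_cons /pushforward cons_rV_box product_measure1E//.
  rewrite (IH _ (r \o lift ord0)); last 2 first.
    by move=> i; exact: mD.
    by move=> i; exact: rD.
  by rewrite EFinM; congr (_ * _)%E; exact: rD.
by apply: measurable_rV_box => i; exact: mD.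
Qed.

(** Fubini for one coordinate. The integrands of interest are signed cosines, so integrability is
    secured by boundedness on a set of finite measure rather than by positivity. *)
Lemma integral_rV_boxS n (D : 'I_n.+1 -> set R) (f : 'rV[R]_n.+1 -> R) :
  (forall i, measurable (D i : set (measurableTypeR R))) ->
  (lebesgue_rV n.+1 (rV_box D) < +oo)%E ->
  measurable_fun setT f -> (exists M, forall x, `|f x| <= M) ->
  (\int[lebesgue_rV n.+1]_(x in rV_box D) (f x)%:E =
   \int[lebesgue_measure]_(a in D ord0)
     \int[lebesgue_rV n]_(y in rV_box (D \o lift ord0)) (f (cons_rV (a, y)))%:E)%E.
Proof.
move=> mD Doo mf [M fM].
have mD' : measurable (rV_box (D \o lift ord0)).
  by apply: measurable_rV_box => i; exact: mD.
have mfc : measurable_fun setT (f \o @cons_rV R n).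
  by apply: measurableT_comp => //; exact: measurable_cons_rV.
have Dint : (lebesgue_measure \x lebesgue_rV n)%E.-integrable
    (D ord0 `*` rV_box (D \o lift ord0)) (EFin \o (f \o @cons_rV R n)).
  apply: measurable_bounded_integrable.
  - exact: measurableX.
  - by rewrite -cons_rV_box.
  - exact: measurable_funTS.
  - exists M; split; first exact: num_real.
    by move=> N MN x _; exact: (le_trans (fM _) (ltW MN)).
rewrite [LHS](@integral_pushforward _ _ _ _ _ _ (@measurable_cons_rV R n)
    (lebesgue_measure \x lebesgue_rV n)%E); last 3 first.
  exact/measurable_EFinP.
  by rewrite cons_rV_box.
  exact: measurable_rV_box.
rewrite cons_rV_box integral_mkcond -integral12_prod_meas1; last first.
  by apply/integrable_restrict => //; [exact: measurableX|rewrite setTI].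
rewrite [RHS]integral_mkcond; apply: eq_integral => a _.
rewrite /fubini_F /patch /=; case: ifPn => aD.
  rewrite [RHS]integral_mkcond; apply: eq_integral => y _.
  rewrite /patch in_setX /=; move: aD; rewrite inE => aD.
  by rewrite [X in X && _]mem_set.
rewrite integral0_eq// => y _; rewrite in_setX/=.
by rewrite (negbTE aD).
Qed.

End rV_box.

(** * Linear combinations of integrable functions with known integrals *)

Section has_integral.
Context d (T : measurableType d) (R : realType).
Variables (mu : {measure set T -> \bar R}) (D : set T).
Hypothesis mD : measurable D.

Definition has_integral (f : T -> R) (r : R) : Prop :=
  mu.-integrable D (EFin \o f) /\ (\int[mu]_(x in D) (f x)%:E)%E = r%:E.

Lemma has_integralD f g r s : has_integral f r -> has_integral g s ->
  has_integral (fun x => f x + g x) (r + s).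
Proof.
move=> [fi fr] [gi gs]; split.
  by have := integrableD mD fi gi; apply: eq_integrable.
under eq_integral do rewrite EFinD.
by rewrite integralD// fr gs.
Qed.

Lemma has_integralZ c f r : has_integral f r ->
  has_integral (fun x => c * f x) (c * r).
Proof.
move=> [fi fr]; split.
  by have := @integrableZl _ _ _ mu D mD c _ fi; apply: eq_integrable.
under eq_integral do rewrite EFinM.
by rewrite integralZl// fr.
Qed.

Lemma has_integral_sum (I : Type) (s : seq I) f r :
  (forall i, has_integral (f i) (r i)) ->
  has_integral (fun x => \sum_(i <- s) f i x) (\sum_(i <- s) r i).
Proof.
move=> fr; split.
  have := @integrable_sum _ _ _ mu D mD I s xpredT _ (fun i _ => (fr i).1).
  by apply: eq_integrable => // x _ /=; rewrite sumEFin.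
under eq_integral do rewrite -sumEFin.
rewrite integral_sum//; last by move=> i; exact: (fr i).1.
by rewrite -sumEFin; apply: eq_bigr => i _; exact: (fr i).2.
Qed.

End has_integral.

(** * Integrals of cosines over boxes *)

Section cos_integral.
Context {R : realType}.

(** The integral of [cos (b * x)] over an interval of length [l] centred at 0. The case [b = 0] is
    separate because division by zero would return 0 instead of [l]. *)
Definition sinc (l b : R) : R := if b == 0 then l else 2 * sin (b * l / 2) / b.

Lemma subr_sin (x y : R) : sin x - sin y = 2 * cos ((x + y) / 2) * sin ((x - y) / 2).
Proof.
have /(congr1 sin) : x = (x + y) / 2 + (x - y) / 2 by lra.
have /(congr1 sin) : y = (x + y) / 2 - (x - y) / 2 by lra.
by rewrite sinB sinD => -> ->; lra.
Qed.

Lemma measurable_cos : measurable_fun [set: R] (@cos R).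
Proof. exact: continuous_measurable_fun (@continuous_cos R). Qed.

Lemma sin_MVT (x : R) : 0 <= x -> exists2 c, 0 <= c <= x & sin x = cos c * x.
Proof.
move=> x0; have [|c] := @MVT_segment _ (@sin R) (@cos R) 0 x x0 (fun y _ => is_derive_sin y).
  by apply: continuous_subspaceT => y; exact: continuous_sin.
by rewrite in_itv/= sin0 !subr0 => cx ->; exists c.
Qed.

Lemma norm_sin_le (x : R) : `|sin x| <= `|x|.
Proof.
wlog x0 : x / 0 <= x.
  move=> H; have [|/ltW xn] := leP 0 x; first exact: H.
  by have := H (- x); rewrite sinN !normrN oppr_ge0 => /(_ xn).
have [c _ ->] := sin_MVT x0.
by rewrite normrM ler_piMl// cos_max.
Qed.

Lemma continuous_cos_affine (t b : R) : continuous (fun x => cos (t + b * x)).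
Proof.
move=> x; apply: (@continuous_comp _ _ _ (fun x => t + b * x) cos).
  by apply: cvgD; [exact: cvg_cst|apply: cvgM; [exact: cvg_cst|exact: cvg_id]].
exact: continuous_cos.
Qed.

(** The antiderivative [b^-1 * sin (t + b * x)] and the sum-to-product formula leave the cosine at
    the midpoint of the interval. The flags cover both the half-open unit box and the closed
    cube. *)
Lemma integral_itv_cos (s0 s1 : bool) (l u t b : R) : l < u ->
  (\int[lebesgue_measure]_(x in [set` Interval (BSide s0 l) (BSide s1 u)])
    (cos (t + b * x))%:E)%E =
  (cos (t + (l + u) / 2 * b) * sinc (u - l) b)%:E.
Proof.
move=> lu.
have mcos : measurable_fun setT (fun x : R => cos (t + b * x)).
  by apply: continuous_measurable_fun; exact: continuous_cos_affine.
have bnd s2 s3 : (\int[lebesgue_measure]_(x in [set` Interval (BSide s2 l) (BSide s3 u)])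
    (cos (t + b * x))%:E)%E =
    (\int[lebesgue_measure]_(x in `]l, u[) (cos (t + b * x))%:E)%E.
  by apply: integral_itv_bndoo; apply/measurable_EFinP/measurable_funTS.
rewrite bnd -(bnd true false) /sinc; case: eqP => [->|/eqP b0].
  under eq_integral do rewrite mul0r addr0.
  rewrite integral_cst//= lebesgue_measure_itv/= lte_fin lu -EFinB -EFinM.
  by rewrite mulr0 addr0.
rewrite (@continuous_FTC2 _ _ (fun x => b^-1 * sin (t + b * x)))//.
- rewrite -EFinB -mulrBr subr_sin; congr (_%:E).
  rewrite (_ : (t + b * u + (t + b * l)) / 2 = t + (l + u) / 2 * b); last by lra.
  rewrite (_ : (t + b * u - (t + b * l)) / 2 = b * (u - l) / 2); last by lra.
  by field.
- by apply: continuous_subspaceT => x; exact: continuous_cos_affine.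
- split.
  + by move=> x _; apply: ex_derive.
  + apply: cvg_at_right_filter; apply: cvgM; first exact: cvg_cst.
    apply: (@continuous_comp _ _ _ (fun x => t + b * x) sin); last exact: continuous_sin.
    by apply: cvgD; [exact: cvg_cst|apply: cvgM; [exact: cvg_cst|exact: cvg_id]].
  + apply: cvg_at_left_filter; apply: cvgM; first exact: cvg_cst.
    apply: (@continuous_comp _ _ _ (fun x => t + b * x) sin); last exact: continuous_sin.
    by apply: cvgD; [exact: cvg_cst|apply: cvgM; [exact: cvg_cst|exact: cvg_id]].
- move=> x _; rewrite derive1E.
  have dlin : is_derive x 1 (fun x => t + b * x) b.
    by apply: is_derive_eq; rewrite /GRing.scale /= add0r mul1r mulr1.
  have dsin := @is_derive1_comp _ sin (fun x => t + b * x) x _ b (is_derive_sin _) dlin.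
  have := @is_deriveZ _ _ _ (sin \o (fun x => t + b * x)) b^-1 x 1 _ dsin.
  rewrite (_ : b^-1 \*: _ = (fun x => b^-1 * sin (t + b * x)))// => dF.
  rewrite (@derive_val _ _ _ _ _ _ _ dF) /GRing.scale /=.
  by rewrite mulrCA mulVf// mulr1.
Qed.

Lemma sinc_le (l b : R) : 0 < l -> `|sinc l b| <= l.
Proof.
move=> l0; rewrite /sinc; case: eqP => [_|/eqP b0]; first by rewrite gtr0_norm.
rewrite normrM normfV normrM ger0_norm// ler_pdivrMr ?normr_gt0//.
have := norm_sin_le (b * l / 2).
by rewrite !normrM (gtr0_norm l0) (ger0_norm (_ : 0 <= 2^-1))//; nra.
Qed.

(** Unlike [sinc_le], this bound does not grow with the length of the interval: it is the gain of
    one power of [T] in a nonresonant direction. *)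
Lemma sinc_le_inv (l b : R) : b != 0 -> `|sinc l b| <= 2 / `|b|.
Proof.
move=> b0; rewrite /sinc (negbTE b0) normrM normrV ?unitfE// normrM.
rewrite ler_pM2r ?invr_gt0 ?normr_gt0//.
by rewrite ger0_norm// ler_piMr// sin_max.
Qed.

Lemma measurable_dotrV n (b : 'rV[R]_n) : measurable_fun setT (dotrV b).
Proof.
rewrite /dotrV; apply: measurable_sum => i.
by apply: measurable_funM; [exact: measurable_cst|exact: measurable_coord].
Qed.

Lemma lebesgue_rV_itv_box (s0 s1 : bool) (l u : R) n : l <= u ->
  lebesgue_rV n (rV_box (fun=> [set` Interval (BSide s0 l) (BSide s1 u)])) =
  ((u - l) ^+ n)%:E.
Proof.
move=> lu; rewrite (@lebesgue_rV_box _ _ _ (fun=> u - l)).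
- by rewrite prodr_const card_ord.
- by move=> i; exact: measurable_itv.
move=> i; rewrite lebesgue_measure_itv/= lte_fin -EFinB.
by case: ltgtP lu => // ->; rewrite subrr.
Qed.

Lemma measurable_itv_box (s0 s1 : bool) (l u : R) n :
  measurable (rV_box (fun=> [set` Interval (BSide s0 l) (BSide s1 u)]) : set 'rV[R]_n).
Proof. by apply: measurable_rV_box => i; exact: measurable_itv. Qed.

Lemma measurable_cos_dotrV n t (b : 'rV[R]_n) :
  measurable_fun setT (fun x => cos (t + dotrV b x)).
Proof.
apply: (measurableT_comp measurable_cos); apply: measurable_funD => //.
exact: measurable_dotrV.
Qed.

Lemma integral_cos_box (s0 s1 : bool) (l u : R) n (t : R) (b : 'rV[R]_n) : l < u ->
  (\int[lebesgue_rV n]_(x in rV_box (fun=> [set` Interval (BSide s0 l) (BSide s1 u)]))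
    (cos (t + dotrV b x))%:E)%E =
  (cos (t + (l + u) / 2 * \sum_i b 0 i) * \prod_i sinc (u - l) (b 0 i))%:E.
Proof.
move=> lu; elim: n t b => [|n IH] t b.
  have mbox := @measurable_itv_box s0 s1 l u 0.
  rewrite integral_dirac//=; last first.
    by apply/measurable_EFinP/measurable_funTS; exact: measurable_cos_dotrV.
  rewrite diracE mem_set ?mul1e; last by case.
  by rewrite /dotrV !big_ord0 mulr0 mulr1.
have lam_itv : lebesgue_measure [set` Interval (BSide s0 l) (BSide s1 u)] = (u - l)%:E.
  by rewrite lebesgue_measure_itv/= lte_fin lu EFinB.
rewrite integral_rV_boxS; last 4 first.
- by move=> i; exact: measurable_itv.
- by have := ltry ((u - l) ^+ n.+1); rewrite -(lebesgue_rV_itv_box s0 s1) 1?ltW.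
- exact: measurable_cos_dotrV.
- by exists 1 => x; exact: cos_max.
(* With the first coordinate [a] fixed, [b 0 ord0 * a] joins the phase, and the induction hypothesis
   applies because it holds for every phase; the result is again a cosine in [a]. *)
under eq_integral => a _.
  under eq_integral => y _.
    rewrite (_ : dotrV b (cons_rV (a, y)) =
        b 0 ord0 * a + dotrV (\row_j b 0 (lift ord0 j)) y); last first.
      rewrite /dotrV big_ord_recl cons_rV0; congr (_ + _).
      by apply: eq_bigr => j _; rewrite cons_rVS mxE.
    rewrite addrA.
    over.
  rewrite IH addrAC mulrC EFinM.
  over.
rewrite integralZl//=; last first.
  apply: measurable_bounded_integrable => //.
  - by rewrite /= lam_itv ltry.
  - apply: measurable_funTS; apply: continuous_measurable_fun.
    exact: continuous_cos_affine.
  - exists 1; split; first exact: num_real.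
    by move=> N MN x _; exact: (le_trans (cos_max _) (ltW MN)).
rewrite integral_itv_cos// -EFinM; congr (_%:E).
set b' := \row_j _.
have b'E i : b' 0 i = b 0 (lift ord0 i) by rewrite mxE.
rewrite !big_ord_recl (eq_bigr _ (fun i _ => b'E i)).
rewrite (eq_bigr _ (fun i _ => congr1 (sinc (u - l)) (b'E i))) mulrCA; congr (cos _ * _).
  by rewrite -addrA -mulrDr [X in _ * X]addrC.
by rewrite mulrC.
Qed.

Lemma has_integral_cos_box (s0 s1 : bool) (l u : R) n (t : R) (b : 'rV[R]_n) : l < u ->
  has_integral (lebesgue_rV n) (rV_box (fun=> [set` Interval (BSide s0 l) (BSide s1 u)]))
    (fun x => cos (t + dotrV b x))
    (cos (t + (l + u) / 2 * \sum_i b 0 i) * \prod_i sinc (u - l) (b 0 i)).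
Proof.
move=> lu; split; last exact: integral_cos_box.
apply: measurable_bounded_integrable.
- exact: measurable_itv_box.
- by have := ltry ((u - l) ^+ n); rewrite -(lebesgue_rV_itv_box s0 s1) 1?ltW.
- by apply: measurable_funTS; exact: measurable_cos_dotrV.
- exists 1; split; first exact: num_real.
  by move=> N MN x _; exact: (le_trans (cos_max _) (ltW MN)).
Qed.

End cos_integral.

(** * The Fejer kernel *)

Section fejer.
Context {R : realType}.

Lemma cos_addzpi2 (x : R) (n : int) : cos (x + n%:~R * (2 * pi)) = cos x.
Proof.
have per (m : nat) y : cos (y + m%:R * (2 * pi)) = cos y :> R.
  by rewrite -[RHS](periodicn (@cosD2pi R) m); congr cos; rewrite -mulr_natl; ring.
case: n => m; first exact: per.
by rewrite -[RHS]cosN -(per m.+1) -[LHS]cosN NegzE mulrNz; congr cos; ring.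
Qed.

Lemma sin_zpi (n : int) : sin (n%:~R * pi) = 0 :> R.
Proof.
have per (m : nat) : sin (m%:R * pi) = 0 :> R.
  elim: m => [|m IH]; first by rewrite mul0r sin0.
  by rewrite -natr1 mulrDl mul1r sinDpi IH oppr0.
by case: n => m; rewrite ?per// NegzE mulrNz mulNr sinN per oppr0.
Qed.

Lemma sinc1_int (n : int) : sinc 1 (2 * pi * n%:~R) = (n == 0)%:R :> R.
Proof.
rewrite /sinc -mulrA mulf_eq0 pnatr_eq0/= mulf_eq0 gt_eqF ?pi_gt0//= intr_eq0.
case: eqP => // n0; rewrite (_ : _ * 1 / 2 = n%:~R * pi); last by field.
by rewrite sin_zpi mulr0 mul0r.
Qed.

Context {k : nat}.
Implicit Types (m : 'I_k -> int) (x y z p u : 'rV[R]_k).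

Lemma dotrV0 x : dotrV x 0 = 0.
Proof. by rewrite /dotrV big1// => i _; rewrite mxE mulr0. Qed.

Lemma dotrV_addr x y z : dotrV x (y + z) = dotrV x y + dotrV x z.
Proof. by rewrite /dotrV -big_split; apply: eq_bigr => i _; rewrite mxE mulrDr. Qed.

Lemma dotrV_oppr x y : dotrV x (- y) = - dotrV x y.
Proof. by rewrite /dotrV -sumrN; apply: eq_bigr => i _; rewrite mxE mulrN. Qed.

Lemma dotrV_scaler c x y : dotrV x (c *: y) = c * dotrV x y.
Proof. by rewrite /dotrV mulr_sumr; apply: eq_bigr => i _; rewrite mxE mulrCA. Qed.

Definition freq m : 'rV[R]_k := \row_i (2 * pi * (m i)%:~R).

Lemma freqD m m' x : dotrV (freq (fun i => m i + m' i)) x =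
  dotrV (freq m) x + dotrV (freq m') x.
Proof.
by rewrite /dotrV -big_split/=; apply: eq_bigr => i _; rewrite !mxE intrD mulrDr mulrDl.
Qed.

Lemma freqN m x : dotrV (freq (fun i => - m i)) x = - dotrV (freq m) x.
Proof.
by rewrite /dotrV -sumrN; apply: eq_bigr => i _; rewrite !mxE mulrNz mulrN mulNr.
Qed.

Lemma freq_delta i x : dotrV (freq (fun i' => (i' == i)%:Z)) x = 2 * pi * x 0 i.
Proof.
rewrite /dotrV (bigD1 i)//= big1 ?addr0; first by rewrite mxE eqxx mulr1.
by move=> j /negbTE ji; rewrite mxE ji mulr0 mul0r.
Qed.

Definition unit_box : set 'rV[R]_k := rV_box (fun=> `[0, 1[%classic).

Lemma measurable_unit_box : measurable unit_box.
Proof. exact: measurable_itv_box. Qed.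

(** Orthogonality of characters: over a full period each nonzero coordinate of [m] makes its [sinc]
    factor vanish, whatever the shift [p]. *)
Lemma has_integral_freq m p :
  has_integral (lebesgue_rV k) unit_box (fun z => cos (dotrV (freq m) (z - p)))
    [forall i, m i == 0]%:R.
Proof.
have := @has_integral_cos_box R true true 0 1 k (- dotrV (freq m) p) (freq m) ltr01.
rewrite subr0 (_ : cos _ * _ = [forall i, m i == 0]%:R).
  by under [X in has_integral _ _ X _ -> _]eq_fun do rewrite addrC -dotrV_oppr -dotrV_addr.
under eq_bigr do rewrite mxE sinc1_int.
have [/forallP m0|/forallPn[i mi]] := boolP [forall i, m i == 0]; last first.
  by rewrite [X in _ * X](bigD1 i)//= (negbTE mi) mul0r mulr0.
rewrite /dotrV !big1 ?mulr0 ?addr0 ?oppr0 ?cos0 ?mulr1// => i _; rewrite ?m0//.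
  by rewrite mxE (eqP (m0 i)) mulr0.
by rewrite mxE (eqP (m0 i)) mulr0 mul0r.
Qed.

Context (N : nat).
Hypothesis N_gt0 : (0 < N)%N.

Local Notation J := {ffun 'I_k -> 'I_N}.
Implicit Types (j l : J).

Definition jfreq (q : J * J) : 'I_k -> int := fun i => (q.1 i)%:Z - (q.2 i)%:Z.

(* This is N^-k |sum_j e(j.u)|^2, j ranging over {0,..,N-1}^k, with the square
   expanded into its real frequencies j - l. *)
Definition fejer u : R := (N%:R ^+ k)^-1 * \sum_(q : J * J) cos (dotrV (freq (jfreq q)) u).

Lemma fejer_ge0 u : 0 <= fejer u.
Proof.
apply: mulr_ge0; first by rewrite invr_ge0 exprn_ge0.
pose th j := dotrV (freq (fun i => (j i)%:Z)) u.
(* The squared modulus in real form: by the formula for [cos (th j - th l)], the sum over pairs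
   splits into the squares of the cosine sum and of the sine sum. *)
rewrite (_ : \sum_(q : J * J) _ = (\sum_(j : J) cos (th j)) ^+ 2 + (\sum_j sin (th j)) ^+ 2).
  by rewrite addr_ge0 ?sqr_ge0.
rewrite !expr2 !mulr_suml -big_split/=.
under [RHS]eq_bigr do rewrite !mulr_sumr -big_split/=.
rewrite pair_big/=; apply: eq_bigr => -[j l] _ /=.
by rewrite -cosB /jfreq/= (freqD _ (fun i => - _)) freqN.
Qed.

Lemma card_J : #|J|%:R = N%:R ^+ k :> R.
Proof. by rewrite card_ffun !card_ord natrX. Qed.

Lemma Nk_neq0 : N%:R ^+ k != 0 :> R.
Proof. by rewrite expf_neq0// pnatr_eq0 -lt0n. Qed.

Lemma jfreq_eq0 (q : J * J) : [forall i, jfreq q i == 0] = (q.1 == q.2).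
Proof.
apply/forallP/eqP => [q0|q12 i]; last by rewrite /jfreq q12 subrr.
by apply/ffunP => i; apply/val_inj/eqP; have := q0 i; rewrite subr_eq0 eqz_nat.
Qed.

Lemma sum_diag : \sum_(q : J * J) (q.1 == q.2)%:R = N%:R ^+ k :> R.
Proof.
rewrite -(pair_bigA _ (fun j l => (j == l)%:R))/= -card_J -sumr_const.
by apply: eq_bigr => j _; rewrite (bigD1 j)//= eqxx big1 ?addr0// => l /negbTE lj; rewrite eq_sym lj.
Qed.

(** Only the [N ^ k] diagonal pairs have frequency zero, and the normalisation divides by exactly
    that number. *)
Lemma has_integral_fejer p :
  has_integral (lebesgue_rV k) unit_box (fun z => fejer (z - p)) 1.
Proof.
rewrite -(mulVf Nk_neq0); apply: has_integralZ; first exact: measurable_unit_box.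
rewrite -sum_diag; apply: has_integral_sum => [|q]; first exact: measurable_unit_box.
by rewrite -jfreq_eq0; exact: has_integral_freq.
Qed.

(** Counts the [j] whose [i]-th coordinate can be raised by one within ['I_N]: there are
    [(N - 1) * N ^ (k - 1)] of them. *)
Lemma sum_shift i : \sum_(j : J) (((j i).+1 < N)%N)%:R = N%:R ^+ k - N%:R ^+ k / N%:R :> R.
Proof.
(* Writing the condition on one coordinate as a product over all coordinates lets the sum over
   functions become a product of sums. *)
pose F (i' : 'I_k) (c : 'I_N) : R := if i' == i then (c.+1 < N)%N%:R else 1.
rewrite (eq_bigr (fun j : J => \prod_i' F i' (j i'))); last first.
  move=> j _; rewrite (bigD1 i)//= big1 ?mulr1; first by rewrite /F eqxx.
  by move=> i' /negbTE i'i; rewrite /F i'i.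
rewrite -bigA_distr_bigA/= (bigD1 i)//= [X in _ * X](eq_bigr (fun=> N%:R)); last first.
  by move=> i' /negbTE i'i; rewrite /F i'i sumr_const card_ord.
rewrite prodr_const cardC1 card_ord.
rewrite (_ : \sum_j F i j = N%:R - 1).
  have -> : N%:R ^+ k = N%:R * N%:R ^+ k.-1 :> R by rewrite -exprS prednK// (leq_ltn_trans _ (ltn_ord i)).
  by field; rewrite pnatr_eq0 -lt0n.
case: N N_gt0 @F => // n _ F.
(* The last ordinal is the only one that cannot be raised; removing it leaves [N - 1] ones. *)
rewrite big_ord_recr/= {2}/F eqxx ltnn addr0 (eq_bigr (fun=> 1)).
  by rewrite sumr_const card_ord -natr1 addrK.
by move=> c _; rewrite /F eqxx /= ltnS ltn_ord.
Qed.

(** Each [j] that can be raised in direction [i] is paired with [l], equal to [j] raised there. A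
    lower bound suffices, since this sum enters the second moment with a negative sign. *)
Lemma sum_jfreq_delta i :
  N%:R ^+ k - N%:R ^+ k / N%:R <=
  \sum_(q : J * J) [forall i', jfreq q i' + (i' == i)%:Z == 0]%:R :> R.
Proof.
rewrite -(sum_shift i).
rewrite -(pair_bigA _ (fun j l : J => [forall i', jfreq (j, l) i' + (i' == i)%:Z == 0]%:R))/=.
apply: ler_sum => j _; case: ltnP => // jN; last by rewrite sumr_ge0.
pose l : J := [ffun i' => if i' == i then Ordinal jN else j i'].
rewrite (bigD1 l)//= ler_wpDr ?sumr_ge0//.
rewrite (_ : [forall _, _]); first by [].
apply/forallP => i'; rewrite /jfreq/= ffunE.
by case: (i' =P i) => [->|_] /=; lia.
Qed.

(** Exchanging the two members of a pair negates [jfreq], which reduces this sum to the previous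
    one. *)
Lemma sum_jfreq_deltaN i :
  N%:R ^+ k - N%:R ^+ k / N%:R <=
  \sum_(q : J * J) [forall i', jfreq q i' - (i' == i)%:Z == 0]%:R :> R.
Proof.
apply: (le_trans (sum_jfreq_delta i)).
rewrite (reindex_inj (h := fun q : J * J => (q.2, q.1))); last first.
  by move=> [j l] [j' l'] [-> ->].
apply: ler_sum => q _; rewrite le_eqVlt; apply/orP; left; apply/eqP.
congr (nat_of_bool _)%:R; apply: eq_forallb => i'.
by rewrite /jfreq/= -oppr_eq0 opprD opprB.
Qed.

(* sin (pi u_i) ^+ 2, a smooth substitute for the squared distance from u_i to
   the integers, in a form that shifts the frequencies of fejer by one. *)
Definition sqsin i u : R := (1 - cos (2 * pi * u 0 i)) / 2.

(** The second moment of the kernel. Multiplying by [cos (2 pi u_i)] shifts each frequency by plus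
    or minus one in direction [i]; nearly all diagonal terms survive the shift, and
    [1/2 - (1 - 1/N) / 2 = 1 / (2N)] remains. *)
Lemma has_integral_sqsin_fejer i p :
  exists2 r, has_integral (lebesgue_rV k) unit_box
    (fun z => sqsin i (z - p) * fejer (z - p)) r & r <= (2 * N%:R)^-1.
Proof.
pose c := (N%:R ^+ k : R)^-1.
pose S1 : R := \sum_(q : J * J) [forall i', jfreq q i' + (i' == i)%:Z == 0]%:R.
pose S2 : R := \sum_(q : J * J) [forall i', jfreq q i' - (i' == i)%:Z == 0]%:R.
have mQ := measurable_unit_box.
have h1 : has_integral (lebesgue_rV k) unit_box (fun z =>
    \sum_(q : J * J) cos (dotrV (freq (jfreq q)) (z - p) + 2 * pi * (z - p) 0 i)) S1.
  apply: has_integral_sum => // q.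
  under eq_fun do rewrite -freq_delta -freqD.
  exact: has_integral_freq.
have h2 : has_integral (lebesgue_rV k) unit_box (fun z =>
    \sum_(q : J * J) cos (dotrV (freq (jfreq q)) (z - p) - 2 * pi * (z - p) 0 i)) S2.
  apply: has_integral_sum => // q.
  under eq_fun do rewrite -freq_delta -freqN -freqD.
  exact: has_integral_freq.
exists (1/2 * 1 + (- (c / 4) * S1 + - (c / 4) * S2)).
  have h := has_integralD mQ (has_integralZ mQ (1/2) (has_integral_fejer p))
    (has_integralD mQ (has_integralZ mQ (- (c / 4)) h1) (has_integralZ mQ (- (c/4)) h2)).
  rewrite (_ : (fun z => _ * _) = (fun z => 1 / 2 * fejer (z - p) + (- (c / 4) *
     \sum_(q : J * J) cos (dotrV (freq (jfreq q)) (z - p) + 2 * pi * (z - p) 0 i) +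
     - (c / 4) * \sum_(q : J * J) cos (dotrV (freq (jfreq q)) (z - p) - 2 * pi * (z - p) 0 i))))//.
  apply/funext => z; move: (z - p) => u.
  rewrite -mulrDr -big_split/= /sqsin.
  under [in RHS]eq_bigr do rewrite cosD cosB.
  rewrite (eq_bigr (fun q => cos (2 * pi * u 0 i) * 2 * cos (dotrV (freq (jfreq q)) u))).
    by rewrite -mulr_sumr /fejer -/c; field.
  by move=> q _; ring.
have := sum_jfreq_delta i; have := sum_jfreq_deltaN i; rewrite -/S1 -/S2 => S2N S1N.
have c0 : 0 < c by rewrite invr_gt0 exprn_gt0// ltr0n.
have : c * (N%:R ^+ k - N%:R ^+ k / N%:R) = 1 - N%:R^-1.
  by rewrite /c; field; rewrite Nk_neq0 pnatr_eq0 -lt0n N_gt0.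
rewrite invfM.
have := ler_wpM2l (ltW c0) S1N; have := ler_wpM2l (ltW c0) S2N.
by move=> + + E; rewrite E; lra.
Qed.

Lemma measurable_fejer : measurable_fun setT fejer.
Proof.
apply: measurable_funM => //; apply: measurable_sum => q.
have := @measurable_cos_dotrV R k 0 (freq (jfreq q)).
by under eq_fun do rewrite add0r.
Qed.

End fejer.

(** * Smoothing *)

Section smoothing.
Context {R : realType} {k d N : nat} (v : d.-tuple 'rV[R]_k).
Hypothesis N_gt0 : (0 < N)%N.

Definition cube (T : R) : set 'rV[R]_d := rV_box (fun=> `[- T, T]%classic).

Lemma measurable_cube T : measurable (cube T).
Proof. exact: measurable_itv_box. Qed.

Lemma lebesgue_cube (T : R) : 0 <= T -> lebesgue_rV d (cube T) = ((2 * T) ^+ d)%:E.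
Proof.
by move=> T0; rewrite lebesgue_rV_itv_box ?ge0_cp// opprK mulr_natl mulr2n.
Qed.

Lemma dotrV_lincomb (b : 'rV[R]_k) (a : 'rV[R]_d) :
  dotrV b (lincomb v a) = dotrV (\row_i dotrV b (tnth v i)) a.
Proof.
rewrite /lincomb (@big_morph _ _ (dotrV b) 0 +%R).
- by apply: eq_bigr => i _; rewrite dotrV_scaler mxE mulrC.
- exact: dotrV_addr.
- exact: dotrV0.
Qed.

(* Integrating cos (2 pi m.L(a)) over a cube in the direction of v_i gains a
   factor 2 / |2 pi m.v_i|. *)
Definition nonresonant (v : d.-tuple 'rV[R]_k) (N : nat) (M : R) : Prop :=
  forall m : 'I_k -> int, ~~ [forall i, m i == 0] -> (forall i, `|m i| <= N%:Z) ->
    exists i, dotrV (freq m) (tnth v i) != 0 :> R /\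
      2 / `|dotrV (freq m) (tnth v i)| <= M.

(** After division by [N ^ k], the [N ^ k] diagonal pairs contribute the volume of the cube, and the
    at most [N ^ (2k)] others contribute at most [(2T) ^ (d-1) * M] each. The bound is uniform in
    [q]. *)
Lemma has_integral_fejer_cube (T M : R) (q : 'rV[R]_k) : 0 < T -> 0 <= M ->
  nonresonant v N M ->
  exists2 r, has_integral (lebesgue_rV d) (cube T)
    (fun a => fejer N (q - lincomb v a)) r &
    r <= (2 * T) ^+ d + N%:R ^+ k * (2 * T) ^+ d.-1 * M.
Proof.
move=> T0 M0 vM.
pose b (p : {ffun 'I_k -> 'I_N} * {ffun 'I_k -> 'I_N}) : 'rV[R]_d :=
  \row_i - dotrV (freq (jfreq p)) (tnth v i).
pose c p : R := cos (dotrV (freq (jfreq p)) q + (- T + T) / 2 * \sum_i b p 0 i) *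
  \prod_i sinc (T - - T) (b p 0 i).
exists ((N%:R ^+ k)^-1 * \sum_p c p).
  apply: has_integralZ; first exact: measurable_cube.
  apply: has_integral_sum => [|p]; first exact: measurable_cube.
  have TT : - T < T by lra.
  have := has_integral_cos_box true false (dotrV (freq (jfreq p)) q) (b p) TT.
  rewrite [X in has_integral _ _ X](_ : _ = fun a => cos (dotrV (freq (jfreq p)) (q - lincomb v a)))//.
  apply/funext => a; rewrite dotrV_addr dotrV_oppr dotrV_lincomb; congr (cos (_ + _)).
  by rewrite /dotrV -sumrN; apply: eq_bigr => i _; rewrite !mxE mulNr.
have T2 : T - - T = 2 * T by lra.
have T20 : 0 < 2 * T by lra.
have cle p : c p <= (p.1 == p.2)%:R * (2 * T) ^+ d + (2 * T) ^+ d.-1 * M.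
  apply: (le_trans (ler_norm _)); rewrite /c normrM normr_prod T2.
  apply: (@le_trans _ _ (\prod_i `|sinc (2 * T) (b p 0 i)|)).
    by rewrite ler_piMl ?prodr_ge0// cos_max.
  case: eqP => [_|/eqP p12].
    rewrite mul1r ler_wpDr//; first by rewrite mulr_ge0// exprn_ge0// ltW.
    rewrite (_ : (2 * T) ^+ d = \prod_(i < d) (2 * T)); last by rewrite prodr_const card_ord.
    by apply: ler_prod => i _; rewrite normr_ge0/= sinc_le.
  rewrite mul0r add0r.
  have [||i [vi0 viM]] := vM (jfreq p).
  - by rewrite jfreq_eq0.
  - by move=> i; rewrite /jfreq; have := ltn_ord (p.1 i); have := ltn_ord (p.2 i); lia.
  (* The nonresonant direction [i] is bounded by [M], each of the other [d - 1] directions trivially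
     by [2 * T]. *)
  rewrite (bigD1 i)//= mulrC ler_pM ?prodr_ge0 ?normr_ge0//.
    rewrite (_ : d.-1 = #|predC1 i|); last by rewrite cardC1 card_ord.
    rewrite -prodr_const.
    by apply: ler_prod => i' _; rewrite normr_ge0/= sinc_le.
  apply: le_trans viM; rewrite mxE -[X in _ / X]normrN sinc_le_inv// oppr_eq0//.
rewrite ler_pdivrMl ?exprn_gt0 ?ltr0n//.
apply: (le_trans (ler_sum _ (fun p _ => cle p))).
rewrite big_split/= -mulr_suml sum_diag sumr_const card_prod.
rewrite mulrDr lerD2l -[_ *+ (_ * _)]mulr_natr natrM card_J le_eqVlt; apply/orP; left; apply/eqP.
by ring.
Qed.

(* Chebyshev: where p is in A and z is not in B, some sqsin i (z - p) is at
   least sigma, so 1_A(p) <= 1_B(z) + sigma^-1 sum_i sqsin i (z - p). *)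
Lemma smoothing_le (A B : set 'rV[R]_k) (sigma : R) (p : 'rV[R]_k) :
  measurable B -> 0 < sigma ->
  (forall p z, A p -> ~ B z -> exists i, sigma <= sqsin i (z - p)) ->
  ((\1_A p)%:E <= \int[lebesgue_rV k]_(z in unit_box) (\1_B z * fejer N (z - p))%:E +
    (k%:R / (2 * N%:R * sigma))%:E)%E.
Proof.
move=> mB sigma0 AB.
have mQ := @measurable_unit_box R k.
have sq0 i z : 0 <= sqsin i (z - p) by rewrite /sqsin divr_ge0// subr_ge0 cos_le1.
have mK : measurable_fun setT (fun z : 'rV[R]_k => fejer N (z - p)).
  apply: (measurableT_comp (@measurable_fejer R k N)).
  apply: measurable_fun_coordP => i; under eq_fun do rewrite !mxE.
  by apply: measurable_funB => //; exact: measurable_coord.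
have msq i : measurable_fun setT (fun z : 'rV[R]_k => sqsin i (z - p)).
  rewrite /sqsin; apply: measurable_funM => //; apply: measurable_funB => //.
  apply: (measurableT_comp measurable_cos); apply: measurable_funM => //.
  under eq_fun do rewrite !mxE.
  by apply: measurable_funB => //; exact: measurable_coord.
pose h (i : 'I_k) (z : 'rV[R]_k) := sqsin i (z - p) * fejer N (z - p).
have h0 i z : 0 <= h i z by rewrite mulr_ge0 ?fejer_ge0.
have mh i : measurable_fun setT (h i) by exact: measurable_funM.
have hint i : (\int[lebesgue_rV k]_(z in unit_box) (h i z)%:E <= ((2 * N%:R)^-1)%:E)%E.
  by have [r [_ ->]] := has_integral_sqsin_fejer N_gt0 i p; rewrite lee_fin.
have [_ Kint] := has_integral_fejer N_gt0 p.
have BK0 z : 0 <= \1_B z * fejer N (z - p) by rewrite mulr_ge0 ?fejer_ge0.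
have mBK : measurable_fun setT (fun z : 'rV[R]_k => \1_B z * fejer N (z - p)).
  by apply: measurable_funM => //; exact: measurable_indic.
have msum : measurable_fun setT (fun z => sigma^-1 * \sum_i h i z).
  by apply: measurable_funM => //; exact: measurable_sum.
have sum0 z : 0 <= sigma^-1 * \sum_i h i z.
  by rewrite mulr_ge0 ?invr_ge0 ?(ltW sigma0)// sumr_ge0.
apply: (@le_trans _ _ (\int[lebesgue_rV k]_(z in unit_box)
    ((\1_B z * fejer N (z - p))%:E + (sigma^-1 * \sum_i h i z)%:E))%E).
  (* The indicator at [p] is multiplied by the integral 1 of the kernel, so that a pointwise
     inequality times the nonnegative kernel can be integrated. *)
  rewrite -[leLHS]mule1 -[X in (_ * X)%E]Kint -ge0_integralZl//; last 2 first.
  - by apply/measurable_EFinP/measurable_funTS.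
  - by move=> z _; rewrite lee_fin fejer_ge0.
  apply: ge0_le_integral => //.
  - by move=> z _; rewrite -EFinM lee_fin mulr_ge0 ?fejer_ge0.
  - by apply/measurable_EFinP/measurable_funTS; exact: measurable_funM.
  - by apply/measurable_EFinP/measurable_funTS; exact: measurable_funD.
  move=> z _; rewrite -EFinM -EFinD lee_fin.
  have -> : \sum_i h i z = (\sum_i sqsin i (z - p)) * fejer N (z - p).
    by rewrite mulr_suml.
  rewrite [leRHS](_ : _ = (\1_B z + sigma^-1 * \sum_i sqsin i (z - p)) *
      fejer N (z - p)); last by ring.
  rewrite ler_wpM2r ?fejer_ge0// !indicE.
  have s0 : 0 <= sigma^-1 * \sum_i sqsin i (z - p).
    by rewrite mulr_ge0 ?invr_ge0 ?(ltW sigma0)// sumr_ge0.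
  have [/[!inE] pA|_] := boolP (p \in A); last by rewrite addr_ge0.
  have [/[!inE] zB|] := boolP (z \in B); first by rewrite lerDl.
  rewrite notin_setE => zB; have [i si] := AB _ _ pA zB.
  rewrite add0r ler_pdivlMl// mulr1 (bigD1 i)//= ler_wpDr// sumr_ge0//.
rewrite ge0_integralD//; last 4 first.
- by move=> z _; rewrite lee_fin.
- by apply/measurable_EFinP/measurable_funTS.
- by move=> z _; rewrite lee_fin.
- by apply/measurable_EFinP/measurable_funTS.
rewrite leeD2l//; under eq_integral do rewrite EFinM -sumEFin.
rewrite ge0_integralZl//; last 3 first.
- by apply: emeasurable_sum => i; apply/measurable_EFinP/measurable_funTS.
- by move=> z _; rewrite sume_ge0// => i _; rewrite lee_fin.
- by rewrite lee_fin invr_ge0 ltW.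
rewrite ge0_integral_sum//; last 2 first.
- by move=> i; apply/measurable_EFinP/measurable_funTS.
- by move=> i z _; rewrite lee_fin.
rewrite (_ : k%:R / _ = sigma^-1 * \sum_(i < k) (2 * N%:R)^-1); last first.
  by rewrite sumr_const card_ord -[_ *+ k]mulr_natl invfM; ring.
rewrite EFinM lee_wpmul2l ?lee_fin ?invr_ge0 ?(ltW sigma0)// -sumEFin.
by apply: lee_sum => i _.
Qed.

Lemma measurable_flow (x : 'rV[R]_k) :
  measurable_fun setT (fun a : 'rV[R]_d => x + lincomb v a).
Proof.
apply: measurable_fun_coordP => i; under eq_fun do rewrite mxE.
apply: measurable_funD => //.
exact: (measurableT_comp (measurable_coord i) (measurable_lincomb v)).
Qed.

(** The pointwise bound at [x + lincomb v a] is integrated over the cube; exchanging the integrals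
    leaves, for each fixed [z] in [B], the time integral of the kernel, which is bounded uniformly
    in [z]. *)
Lemma smoothing_cube_le (A B : set 'rV[R]_k) (sigma T M : R) (x : 'rV[R]_k) :
  measurable A -> measurable B -> 0 < sigma -> 0 < T -> 0 <= M ->
  (forall p z, A p -> ~ B z -> exists i, sigma <= sqsin i (z - p)) ->
  nonresonant v N M ->
  (\int[lebesgue_rV d]_(a in cube T) (\1_A (x + lincomb v a))%:E <=
   lebesgue_rV k (B `&` unit_box) * ((2 * T) ^+ d)%:E +
   (N%:R ^+ k * (2 * T) ^+ d.-1 * M + (2 * T) ^+ d * (k%:R / (2 * N%:R * sigma)))%:E)%E.
Proof.
move=> mA mB sigma0 T0 M0 AB vM.
have mQ := @measurable_unit_box R k; have mC := measurable_cube T.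
have mBQ : measurable (B `&` unit_box) by exact: measurableI.
pose g (a : 'rV[R]_d) (z : 'rV[R]_k) := \1_B z * fejer N (z - (x + lincomb v a)).
have g0 a z : 0 <= g a z by rewrite mulr_ge0 ?fejer_ge0.
(* Both domains enter as indicators, so Tonelli applies to a nonnegative function on the whole
   product space. *)
pose G (w : 'rV[R]_d * 'rV[R]_k) : \bar R :=
  (\1_(cube T) w.1 * (\1_unit_box w.2 * g w.1 w.2))%:E.
have G0 w : (0 <= G w)%E by rewrite /G lee_fin; apply: mulr_ge0 => //; apply: mulr_ge0 => //; exact: g0.
have mG : measurable_fun setT G.
  apply/measurable_EFinP; apply: measurable_funM.
    exact: (measurableT_comp (measurable_indic _) measurable_fst).
  apply: measurable_funM.
    exact: (measurableT_comp (measurable_indic _) measurable_snd).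
  apply: measurable_funM.
    exact: (measurableT_comp (measurable_indic _) measurable_snd).
  apply: (measurableT_comp (@measurable_fejer R k N)).
  apply: measurable_fun_coordP => i; under eq_fun do rewrite !mxE.
  apply: measurable_funB.
    exact: (measurableT_comp (measurable_coord i) measurable_snd).
  apply: measurable_funD => //.
  apply: (measurableT_comp (measurable_coord i)).
  exact: (measurableT_comp (measurable_lincomb v) measurable_fst).
have cst0 : 0 <= k%:R / (2 * N%:R * sigma).
  by rewrite divr_ge0// mulr_ge0 ?(ltW sigma0).
have Gint a : (\int[lebesgue_rV k]_z G (a, z) =
    (\1_(cube T) a)%:E * \int[lebesgue_rV k]_(z in unit_box) (g a z)%:E)%E.
  rewrite [X in (_ * X)%E]integral_mkcond -ge0_integralZl//; last 2 first.
  - apply/(measurable_restrictT _ _).1 => //; apply/measurable_EFinP/measurable_funTS.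
    apply: measurable_funM; first exact: measurable_indic.
    apply: (measurableT_comp (@measurable_fejer R k N)).
    apply: measurable_fun_coordP => i; under eq_fun do rewrite !mxE.
    by apply: measurable_funB => //; exact: measurable_coord.
  - by move=> z _; apply: erestrict_ge0 => z' _; rewrite lee_fin.
  apply: eq_integral => z _; rewrite /G/= EFinM; congr (_ * _)%E.
  by rewrite /patch indicE; case: ifPn => _; rewrite ?mul1r ?mul0r.
have FG := @fubini_tonelli _ _ _ _ _ (lebesgue_rV d) (lebesgue_rV k) G mG G0.
apply: (@le_trans _ _ (\int[lebesgue_rV d]_(a in cube T)
    ((\int[lebesgue_rV k]_z G (a, z)) + (k%:R / (2 * N%:R * sigma))%:E))%E).
  apply: ge0_le_integral => //.
  - apply/measurable_EFinP/measurable_funTS.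
    exact: (measurableT_comp (measurable_indic _) (measurable_flow x)).
  - apply: emeasurable_funD => //; apply: measurable_funTS.
    exact: measurable_fun_fubini_tonelli_F.
  move=> a aT; rewrite Gint [\1_(cube T) a]indicE mem_set// mul1e.
  exact: smoothing_le.
rewrite ge0_integralD//; last 2 first.
- by move=> a _; exact: integral_ge0.
- by apply: measurable_funTS; exact: measurable_fun_fubini_tonelli_F.
rewrite integral_cst// [X in (_ + _ * X)%E](lebesgue_cube (ltW T0)).
rewrite [X in (X + _ <= _)%E](_ : _ = \int[lebesgue_rV d]_a \int[lebesgue_rV k]_z G (a, z))%E; last first.
  rewrite integral_mkcond; apply: eq_integral => a _; rewrite /patch.
  by case: ifPn => // aT; rewrite Gint indicE (negbTE aT) mul0e.
rewrite /fubini_F /fubini_G in FG; rewrite FG.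
rewrite EFinD addeA -EFinM [k%:R / _ * _]mulrC leeD2r//.
pose E := (2 * T) ^+ d + N%:R ^+ k * (2 * T) ^+ d.-1 * M.
have Td n : 0 <= (2 * T) ^+ n by rewrite exprn_ge0// mulr_ge0// ltW.
have E0 : 0 <= N%:R ^+ k * (2 * T) ^+ d.-1 * M by rewrite !mulr_ge0// exprn_ge0.
apply: (@le_trans _ _ (\int[lebesgue_rV k]_z ((\1_(B `&` unit_box) z)%:E * E%:E))%E).
  apply: ge0_le_integral => //.
  - by move=> z _; exact: integral_ge0.
  - exact: measurable_fun_fubini_tonelli_G.
  - by apply: emeasurable_funM => //; apply/measurable_EFinP; exact: measurable_indic.
  move=> z _; have [r [_ rint] rE] := has_integral_fejer_cube (z - x) T0 M0 vM.
  rewrite (_ : \int[_]_a _ = (\1_(B `&` unit_box) z)%:E * r%:E)%E.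
    by rewrite lee_wpmul2l ?lee_fin.
  rewrite -rint [X in (_ * X)%E]integral_mkcond -ge0_integralZl//; last 2 first.
  - apply/(measurable_restrictT _ _).1 => //; apply/measurable_EFinP/measurable_funTS.
    apply: (measurableT_comp (@measurable_fejer R k N)).
    apply: measurable_fun_coordP => i; under eq_fun do rewrite !mxE.
    apply: measurable_funB => //.
    exact: (measurableT_comp (measurable_coord i) (measurable_lincomb v)).
  - by move=> a _; apply: erestrict_ge0 => a' _; rewrite lee_fin fejer_ge0.
  apply: eq_integral => a _; rewrite /G/g/= opprD addrA indicI /patch/=.
  by rewrite [\1_(cube T) a]indicE; case: ifPn => _; rewrite ?mule0 -?EFinM; congr (_%:E) => /=; ring.
rewrite ge0_integralZr//; last 2 first.
- by apply/measurable_EFinP; exact: measurable_indic.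
- by rewrite lee_fin addr_ge0.
rewrite integral_indic// setIT /E EFinD.
(* The main term keeps the volume of [B] in the unit box; in the oscillatory error that volume is
   replaced by its bound 1. *)
rewrite ge0_muleDr ?lee_fin// leeD2l// -[leRHS]mul1e lee_wpmul2r ?lee_fin//.
have := @lebesgue_rV_itv_box R true true 0 1 k ler01.
rewrite subr0 expr1n => <-; by apply: le_measure; rewrite ?inE//.
Qed.

End smoothing.

(** * Boxes modulo the lattice *)

Section periodic_boxes.
Context {R : realType}.

Local Notation I01 := (`[0%R, 1%R[%classic : set R).

(** [sqsin] is the squared sine of [pi * u_i], which increases with the distance from [u_i] to the
    integers up to one half. It therefore suffices to bound [sin (pi * e)] from below. *)
Lemma sqsin_ge k (i : 'I_k) (u : 'rV[R]_k) (e : R) : 0 < e <= 4^-1 ->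
  (forall n : int, e < `|u 0 i - n%:~R|) -> 2 * e ^+ 2 <= sqsin i u.
Proof.
move=> /andP[e0 e4] ue; rewrite /sqsin.
have pi2 := @pi_ge2 R.
have [f [fe f2 ->]] : exists f, [/\ e <= f, f <= 2^-1 &
    cos (2 * pi * u 0 i) = cos (2 * pi * f)].
  pose n := Num.floor (u 0 i); pose f := u 0 i - n%:~R.
  have uf : u 0 i = f + n%:~R by rewrite subrK.
  have f0 : 0 <= f by rewrite subr_ge0 floor_le_tmp.
  have f1 : f < 1 by rewrite ltrBlDl -intrD1 floorD1_gt.
  have cosf : cos (2 * pi * u 0 i) = cos (2 * pi * f).
    by rewrite uf -(cos_addzpi2 (2 * pi * f) n); congr cos; ring.
  have := ue n; rewrite -/f ger0_norm// => fe.
  have [f2|/ltW f2] := leP f 2^-1; first by exists f; split => //; exact: ltW.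
  exists (1 - f); split; last 1 first.
  - rewrite cosf -cosN -(cos_addzpi2 _ 1); congr cos; ring.
  - have := ue (n + 1); rewrite intrD uf ler0_norm; lra.
  - lra.
have cosle : cos (2 * pi * f) <= cos (2 * pi * e).
  have [->//|fe'] := eqVneq e f.
  apply/ltW; rewrite ltr_cos ?in_itv/=; last 2 first.
  - by apply/andP; split; nra.
  - by apply/andP; split; nra.
  by rewrite ltr_pM2l ?lt_neqAle ?fe'//; lra.
have [|c /andP[c0 cpe] sinpe] := @sin_MVT R (pi * e); first by nra.
have cosc : 1 / 2 <= cos c ^+ 2.
  have := @cos_ge0_pihalf R (c *+ 2); rewrite cos_mulr2n -[c *+ 2]mulr_natl -[cos c ^+ 2 *+ 2]mulr_natl.
  have -> : - (pi / 2) <= 2 * c <= pi / 2 by apply/andP; split; nra.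
  by move=> /(_ isT); lra.
have cos2 : cos (2 * pi * e) = 1 - 2 * sin (pi * e) ^+ 2.
  have -> : 2 * pi * e = (pi * e) *+ 2 by rewrite -mulrA mulr_natl.
  by rewrite cos_mulr2n cos2sin2 [(1 - _) *+ 2]mulr2n; lra.
have : 2 * e ^+ 2 <= sin (pi * e) ^+ 2.
  rewrite sinpe exprMn exprMn.
  have : 4 * e ^+ 2 <= pi ^+ 2 * e ^+ 2 by rewrite ler_wpM2r ?sqr_ge0//; nra.
  have := sqr_ge0 e; nra.
lra.
Qed.

(** Working modulo 1 by translates allows an enlarged side to cover the whole circle and a shrunken
    side to be empty ([b < a]), without case distinctions. *)
Definition modZ (a b : R) : set R := [set t | exists n : int, a <= t + n%:~R <= b].

Lemma measurable_modZ a b : measurable (modZ a b : set (measurableTypeR R)).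
Proof.
rewrite (_ : modZ a b = \bigcup_(n in [set: int]) `[a - n%:~R, b - n%:~R]%classic).
  by apply: countable_bigcupT_measurable => // n; exact: measurable_itv.
apply/seteqP; split => [t [n tn]|t [n _ /=]]; last first.
  by rewrite in_itv/= lerBlDr lerBrDr => tn; exists n.
by exists n => //=; rewrite in_itv/= lerBlDr lerBrDr.
Qed.

Lemma lebesgue_modZ_le (a e : R) : 0 <= e < 1 ->
  (lebesgue_measure (modZ a (a + e) `&` I01) <= e%:E)%E.
Proof.
move=> /andP[e0 e1].
pose n := Num.floor a; pose f := a - n%:~R.
have f0 : 0 <= f by rewrite subr_ge0 floor_le_tmp.
have f1 : f < 1 by rewrite ltrBlDl -intrD1 floorD1_gt.
have fa : a = f + n%:~R by rewrite subrK.
have tf t : (modZ a (a + e) `&` I01) t ->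
    (f <= t <= f + e /\ t < 1) \/ 0 <= t <= f + e - 1.
  move=> [[m /andP[]]]; rewrite fa /= in_itv/= => h1 h2 /andP[t0 t1].
  have : f <= t + (m - n)%:~R <= f + e by rewrite intrB; apply/andP; split; lra.
  (* Since [0 <= t < 1] and [f + e < 2], the relative translate is 0 (the interval itself) or 1 (the
     piece wrapping past 1). *)
  case: (m - n) => [[|[|j]]|j] /andP[g1 g2].
  - left; split => //; apply/andP; split; lra.
  - right; apply/andP; split; lra.
  - exfalso; move: g2; rewrite -[j.+2]addn2 PoszD intrD.
    have : 0 <= (j%:Z)%:~R :> R by rewrite ler0z.
    rewrite /=; lra.
  - exfalso; move: g1; rewrite NegzE -[j.+1]addn1 PoszD intrN intrD.
    have : 0 <= (j%:Z)%:~R :> R by rewrite ler0z.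
    rewrite /=; lra.
have itvE (x y : R) : x <= y -> lebesgue_measure `[x, y]%classic = (y - x)%:E.
  rewrite lebesgue_measure_itv/= lte_fin -EFinB.
  by case: ltgtP => // ->; rewrite subrr.
have mI := measurableI _ _ (measurable_modZ a (a + e)) (measurable_itv `[0, 1[).
have [fe1|fe1] := ltP (f + e) 1.
  apply: (@le_trans _ _ (lebesgue_measure `[f, f + e]%classic)).
    apply: le_measure; rewrite ?inE//.
    by move=> t /tf[[]|/andP[]]//; rewrite /= in_itv/=; lra.
  by rewrite itvE ?lee_fin; lra.
apply: (@le_trans _ _ (lebesgue_measure (`[f, 1]%classic `|` `[0, f + e - 1]%classic))).
  apply: le_measure; rewrite ?inE//; first exact: measurableU.
  move=> t /tf[[/andP[? ?] ?]|?]; [left|right]; rewrite /= in_itv/=; last by [].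
  by apply/andP; split; lra.
apply: (le_trans (measureU2 _ _ _)) => //.
rewrite [X in (X + _ <= _)%E](_ : _ = (1 - f)%:E); last exact: itvE (ltW f1).
rewrite [X in (_ + X <= _)%E](_ : _ = (f + e - 1 - 0)%:E); last first.
  by apply: itvE; lra.
by rewrite -EFinD lee_fin; lra.
Qed.

Lemma measure_bigsetU_le d (T : measurableType d) (mu : {measure set T -> \bar R})
    (I : Type) (s : seq I) (F : I -> set T) : (forall i, measurable (F i)) ->
  (mu (\big[setU/set0]_(i <- s) F i) <= \sum_(i <- s) mu (F i))%E.
Proof.
move=> mF; elim: s => [|i s IH]; first by rewrite !big_nil measure0.
rewrite !big_cons; apply: (le_trans (measureU2 _ _ _)) => //.
  exact: bigsetU_measurable.
by rewrite leeD2l.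
Qed.

Context {k : nat}.
Implicit Types (a b : 'rV[R]_k) (e : R).

Definition modZ_box a b : set 'rV[R]_k := rV_box (fun i => modZ (a 0 i) (b 0 i)).

Lemma measurable_modZ_box a b : measurable (modZ_box a b).
Proof. by apply: measurable_rV_box => i; exact: measurable_modZ. Qed.

(** By contradiction, in a coordinate where [z] leaves the enlarged box: if [z - p] were within [e]
    of an integer [n] there, the translate [m] that works for [p] would give [m - n] for [z]. *)
Lemma modZ_box_near a b e p z : modZ_box a b p -> ~ modZ_box (a - const_mx e) (b + const_mx e) z ->
  exists i, forall n : int, e < `|(z - p) 0 i - n%:~R|.
Proof.
move=> pab /existsNP[i zi]; exists i => n; rewrite ltNge; apply/negP => zp.
apply: zi; have [m /andP[am bm]] := pab i; exists (m - n).
move: zp; rewrite !mxE intrB ler_norml => /andP[h1 h2].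
by apply/andP; split; lra.
Qed.

Definition strip (i : 'I_k) (a e : R) : set 'rV[R]_k :=
  rV_box (fun i' => if i' == i then modZ a (a + e) `&` I01 else I01).

Lemma measurable_strip i (c e : R) : measurable (strip i c e).
Proof.
apply: measurable_rV_box => i'; case: eqP => _; last exact: measurable_itv.
by apply: measurableI; [exact: measurable_modZ|exact: measurable_itv].
Qed.

Lemma lebesgue_strip_le i (c e : R) : 0 <= e < 1 -> (lebesgue_rV k (strip i c e) <= e%:E)%E.
Proof.
move=> e01; pose r := fine (lebesgue_measure (modZ c (c + e) `&` I01)).
have := lebesgue_modZ_le c e01.
have rE : lebesgue_measure (modZ c (c + e) `&` I01) = r%:E.
  rewrite /r fineK// ge0_fin_numE; first by rewrite (le_lt_trans (lebesgue_modZ_le c e01))// ltry.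
  exact: measure_ge0.
rewrite rE lee_fin => re.
rewrite /strip (@lebesgue_rV_box _ _ _ (fun i' => if i' == i then r else 1)).
- rewrite (bigD1 i)//= eqxx big1 ?mulr1 ?lee_fin// => i' /negbTE ->//.
- move=> i'; case: eqP => _; last exact: measurable_itv.
  by apply: measurableI; [exact: measurable_modZ|exact: measurable_itv].
- move=> i'; case: eqP => _ //.
  by rewrite lebesgue_measure_itv/= lte_fin ltr01 oppr0 adde0.
Qed.

(** A point gained by the enlargement has some coordinate in one of the collars [[a_i - e, a_i]] and
    [[b_i, b_i + e]] modulo 1; the [2k] resulting strips have volume at most [e] each. *)
Lemma lebesgue_modZ_box_expand a b e : 0 <= e < 1 ->
  (lebesgue_rV k (modZ_box (a - const_mx e) (b + const_mx e) `&` unit_box) <=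
   lebesgue_rV k (modZ_box a b `&` unit_box) + (k%:R * (2 * e))%:E)%E.
Proof.
move=> e01; have /andP[e0 e1] := e01.
have mQ := @measurable_unit_box R k.
have mS i : measurable (strip i (a 0 i - e) e `|` strip i (b 0 i) e).
  by apply: measurableU; exact: measurable_strip.
have mbig : measurable (\big[setU/set0]_i (strip i (a 0 i - e) e `|` strip i (b 0 i) e)).
  by apply: bigsetU_measurable.
have mab := measurableI _ _ (measurable_modZ_box a b) mQ.
apply: (@le_trans _ _ (lebesgue_rV k (modZ_box a b `&` unit_box `|`
    \big[setU/set0]_i (strip i (a 0 i - e) e `|` strip i (b 0 i) e)))).
  apply: le_measure; rewrite ?inE; [|exact: measurableU|].
    by apply: measurableI => //; exact: measurable_modZ_box.
  move=> t [tab tQ]; have [tin|] := pselect (modZ_box a b t); first by left.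
  move=> /existsNP[i ti]; right; rewrite -bigcup_seq; exists i.
    by rewrite /= mem_index_enum.
  have [n] := tab i; rewrite !mxE => /andP[an bn].
  have tQ' s c : c <= t 0 i + n%:~R <= c + e -> strip i c e t.
    move=> tc i'; case: eqP => [->|_]; last exact: tQ.
    by split; [exists n|exact: tQ].
  have [ta|ta] := leP (t 0 i + n%:~R) (a 0 i).
    by left; apply: tQ' => //; apply/andP; split; lra.
  have [tb|tb] := leP (b 0 i) (t 0 i + n%:~R).
    by right; apply: tQ' => //; apply/andP; split; lra.
  by exfalso; apply: ti; exists n; rewrite !ltW.
apply: (le_trans (measureU2 _ _ _)) => //.
rewrite leeD2l//; apply: (le_trans (measure_bigsetU_le _ _ _)) => //.
rewrite (_ : k%:R * (2 * e) = \sum_(i < k) (e + e)); last first.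
  by rewrite sumr_const card_ord -mulr_natl; ring.
rewrite -sumEFin; apply: lee_sum => i _.
apply: (le_trans (measureU2 _ _ _)); try exact: measurable_strip.
by rewrite EFinD; apply: leeD; exact: lebesgue_strip_le.
Qed.

End periodic_boxes.

(** * Discrepancy of a periodic box *)

Section discrepancy.
Context {R : realType} {k d : nat} (v : d.-tuple 'rV[R]_k).

Lemma sqsinN (i : 'I_k) (u : 'rV[R]_k) : sqsin i (- u) = sqsin i u.
Proof. by rewrite /sqsin mxE mulrN cosN. Qed.

Lemma lebesgue_unit_boxI (A : set 'rV[R]_k) : measurable A ->
  exists2 r, lebesgue_rV k (A `&` unit_box) = r%:E & 0 <= r <= 1.
Proof.
move=> mA; have mQ := @measurable_unit_box R k.
have Q1 : (lebesgue_rV k (A `&` unit_box) <= 1%:E)%E.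
  have := @lebesgue_rV_itv_box R true true 0 1 k ler01.
  by rewrite subr0 expr1n => <-; apply: le_measure; rewrite ?inE//; exact: measurableI.
have Q0 : (0%:E <= lebesgue_rV k (A `&` unit_box))%E by [].
exists (fine (lebesgue_rV k (A `&` unit_box))).
  by rewrite fineK// ge0_fin_numE// (le_lt_trans Q1)// ltry.
rewrite -!lee_fin fineK ?Q0//.
by rewrite ge0_fin_numE// (le_lt_trans Q1)// ltry.
Qed.

Lemma lebesgue_unit_boxC (A : set 'rV[R]_k) r : measurable A ->
  lebesgue_rV k (A `&` unit_box) = r%:E ->
  lebesgue_rV k (~` A `&` unit_box) = (1 - r)%:E.
Proof.
move=> mA rA; have mQ := @measurable_unit_box R k.
have [s sA _] := lebesgue_unit_boxI (measurableC mA).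
have := @lebesgue_rV_itv_box R true true 0 1 k ler01.
rewrite subr0 expr1n -/unit_box -[X in lebesgue_rV k X](setTI unit_box).
rewrite -(setUv A) setIUl measureU; last 3 first.
- exact: measurableI.
- by apply: measurableI => //; exact: measurableC.
- by rewrite setIACA setICr set0I.
rewrite [X in (X + _)%E]rA [X in (_ + X)%E]sA -EFinD => -[] <-.
by rewrite sA; congr (_%:E); lra.
Qed.

(** The times spent in a set and in its complement add up to the volume of the cube, which turns an
    upper bound for the complement into a lower bound for the set. *)
Lemma indic_flow_integral (A : set 'rV[R]_k) (T : R) (x : 'rV[R]_k) :
  0 < T -> measurable A -> exists2 r,
    (\int[lebesgue_rV d]_(a in cube T) (\1_A (x + lincomb v a))%:E)%E = r%:E &
    (\int[lebesgue_rV d]_(a in cube T) (\1_(~` A) (x + lincomb v a))%:E)%E =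
      ((2 * T) ^+ d - r)%:E.
Proof.
move=> T0 mA.
have mC := @measurable_cube R d T.
have h B : measurable B -> exists r,
    (\int[lebesgue_rV d]_(a in cube T) (\1_B (x + lincomb v a))%:E)%E = r%:E.
  move=> mB; exists (fine (\int[lebesgue_rV d]_(a in cube T) (\1_B (x + lincomb v a))%:E)%E).
  rewrite fineK//; apply: integrable_fin_num => //.
  apply: measurable_bounded_integrable => //.
  - by have := ltry ((2 * T) ^+ d); rewrite -(@lebesgue_cube R d _ (ltW T0)).
  - apply: measurable_funTS.
    exact: (measurableT_comp (measurable_indic _) (measurable_flow v x)).
  - exists 1; split; first exact: num_real.
    move=> N N1 a _; rewrite /= indicE ger0_norm//.
    by apply: le_trans (ltW N1); case: (_ \in _).
have [r rE] := h _ mA; have [s sE] := h _ (measurableC mA).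
exists r => //; rewrite sE; congr (_%:E).
have mind B : measurable B ->
    measurable_fun (cube T) (fun a : 'rV[R]_d => (\1_B (x + lincomb v a))%:E).
  move=> mB; apply/measurable_EFinP/measurable_funTS.
  exact: (measurableT_comp (measurable_indic _) (measurable_flow v x)).
have : ((\int[lebesgue_rV d]_(a in cube T)
   ((\1_A (x + lincomb v a))%:E + (\1_(~` A) (x + lincomb v a))%:E)) = ((2 * T) ^+ d)%:E)%E.
  under eq_integral => a _.
    rewrite -EFinD !indicE in_setC (_ : _ + _ = 1); last by case: (_ \in A); rewrite ?addr0 ?add0r.
    over.
  by rewrite integral_cst// mul1e [LHS](@lebesgue_cube R d _ (ltW T0)).
rewrite ge0_integralD//; last 2 first.
- exact: mind.
- by apply: mind; exact: measurableC.
by rewrite rE sE -EFinD => -[] <-; lra.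
Qed.

(** The three error terms are the volume of the collars, the nonconstant frequencies, and the
    Chebyshev tail with [sigma = 2 * e ^+ 2] from [sqsin_ge]. *)
Lemma modZ_box_discrepancy (N : nat) (a b x : 'rV[R]_k) (T e M : R) :
  (0 < N)%N -> 0 < e <= 4^-1 -> 0 < T -> 0 <= M ->
  nonresonant v N M ->
  exists I r : R,
    [/\ (\int[lebesgue_rV d]_(t in cube T) (\1_(modZ_box a b) (x + lincomb v t))%:E)%E = I%:E,
        lebesgue_rV k (modZ_box a b `&` unit_box) = r%:E &
        `|I - r * (2 * T) ^+ d| <= k%:R * (2 * e) * (2 * T) ^+ d +
          (N%:R ^+ k * (2 * T) ^+ d.-1 * M + (2 * T) ^+ d * (k%:R / (2 * N%:R * (2 * e ^+ 2))))].
Proof.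
move=> N0 e01 T0 M0 vM; have /andP[e0 e4] := e01.
have e1 : 0 <= e < 1 by apply/andP; split; lra.
have s0 : 0 < 2 * e ^+ 2 by rewrite mulr_gt0// exprn_gt0.
have Td : 0 <= (2 * T) ^+ d by rewrite exprn_ge0// mulr_ge0// ltW.
have mab := measurable_modZ_box a b.
(* The shrunken box is chosen so that its enlargement by [e] is exactly the given box. *)
pose ai := a + const_mx e; pose bi := b - const_mx e.
have inner : modZ_box (ai - const_mx e) (bi + const_mx e) = modZ_box a b.
  by rewrite /ai /bi addrK subrK.
have mi := measurable_modZ_box ai bi.
pose ao := a - const_mx e; pose bo := b + const_mx e.
have mo := measurable_modZ_box ao bo.
have [r rE _] := lebesgue_unit_boxI mab.
have [ri riE _] := lebesgue_unit_boxI mi.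
have [ro roE _] := lebesgue_unit_boxI mo.
have [I IE ICE] := indic_flow_integral x T0 mab.
exists I, r; split => //.
set E := N%:R ^+ k * _ * _ + _.
have := lebesgue_modZ_box_expand a b e1; rewrite [leLHS]roE rE -EFinD lee_fin => oE.
have := lebesgue_modZ_box_expand ai bi e1; rewrite inner [leLHS]rE riE -EFinD lee_fin => iE.
have := @smoothing_cube_le R k d N v N0 _ _ (2 * e ^+ 2) T M x mab mo s0 T0 M0.
rewrite IE roE -EFinM -EFinD lee_fin -/E => /(_ _ vM) U1.
have := @smoothing_cube_le R k d N v N0 _ _ (2 * e ^+ 2) T M x
  (measurableC mab) (measurableC mi) s0 T0 M0.
rewrite ICE (lebesgue_unit_boxC mi riE) -EFinM -EFinD lee_fin -/E => /(_ _ vM) L1.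
have {}U1 : I <= ro * (2 * T) ^+ d + E.
  apply: U1 => p z pab /(modZ_box_near pab)[i iz]; exists i.
  exact: sqsin_ge.
(* For complements the roles are exchanged: [z] lies in the shrunken box and [p] outside the given
   one. Evenness of [sqsin] absorbs the sign of the difference. *)
have {}L1 : (2 * T) ^+ d - I <= (1 - ri) * (2 * T) ^+ d + E.
  apply: L1 => p z /= pab /contrapT zi.
  have [|i iz] := @modZ_box_near R k ai bi e z p zi; first by rewrite inner.
  by exists i; rewrite -sqsinN opprB; exact: sqsin_ge.
have {}oE := ler_wpM2r Td oE; have {}iE := ler_wpM2r Td iE.
by rewrite ler_norml; apply/andP; split; lra.
Qed.

(** A Diophantine [w] in [V] is a combination of the [v_i] whose coefficients have absolute sum [S].
    If every [m.v_i] were below [B], then [m.w] would be at most [S * B], contradicting its lower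
    bound [(1 + S) * B]. *)
Lemma diophantine_basis (V : {vspace 'rV[R]_k}) : basis_of V v ->
  diophantine_subspace V -> exists c s : R, [/\ 0 < c, 0 < s &
    forall m : 'I_k -> int, ~~ [forall i, m i == 0] ->
    forall N : nat, (0 < N)%N -> (forall i, `|m i| <= N%:Z) ->
    exists i, c * N%:R `^ (- s) <= `|dotrV (freq m) (tnth v i)|].
Proof.
move=> vV [w wV [c [s [c0 s0 wm]]]].
pose S := \sum_i `|coord v i w|.
have S0 : 0 <= S by rewrite sumr_ge0.
(* Using [1 + S] keeps the divisor positive and makes the final contradiction strict. *)
exists (c / (1 + S)), s; split => //; first by rewrite divr_gt0// ltr_pwDl.
move=> m m0 N N0 mN.
pose mr : 'rV[R]_k := \row_i (m i)%:~R.
have mr0 : mr != 0.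
  apply: contra m0 => /eqP mr0; apply/forallP => i.
  by have := congr1 (fun u : 'rV_k => u 0 i) mr0; rewrite !mxE => /eqP; rewrite intr_eq0.
have mrZ : mr \in @int_lattice R k.
  by rewrite unfold_in; apply/forallP => i; rewrite mxE; exact: intr_int.
have mrN : `|mr| <= N%:R.
  have [i ->] : exists i, `|mr| = `|mr i.1 i.2| by apply: mx_norm_neq0; rewrite -[mx_norm _]/(`|mr|) normr_eq0.
  by rewrite mxE -intr_norm -[N%:R]/(N%:~R) ler_int.
have /(_ mr mrZ mr0) := wm; move=> cw.
(* As the exponent is negative, replacing the norm of [m] by the larger [N] only weakens the
   bound. *)
have {cw} : c * N%:R `^ (- s) <= `|dotrV mr w|.
  apply: le_trans cw; rewrite ler_wpM2l ?(ltW c0)// !powRN.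
  rewrite lef_pV2 ?posrE ?powR_gt0 ?normr_gt0// ?ltr0n//.
  by apply: ge0_ler_powR; rewrite ?nnegrE// ltW.
rewrite (coord_basis vV wV) (@big_morph _ _ (dotrV mr) 0 +%R); last 2 first.
  exact: dotrV_addr.
  exact: dotrV0.
move=> cw; apply: contrapT => /forallNP vi.
pose B := c / (1 + S) * N%:R `^ (- s).
have B0 : 0 < B by rewrite mulr_gt0// ?divr_gt0 ?ltr_pwDl ?powR_gt0 ?ltr0n.
have freqE y : dotrV (freq m) y = 2 * pi * dotrV mr y.
  by rewrite /dotrV mulr_sumr; apply: eq_bigr => i _; rewrite !mxE mulrA.
have vB i : `|dotrV mr (tnth v i)| <= B.
  apply/ltW; have /negP := vi i; rewrite -ltNge; apply: le_lt_trans.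
  rewrite freqE normrM ler_peMl// ger0_norm ?mulr_ge0 ?pi_ge0//.
  have := @pi_ge2 R; lra.
have : `|\sum_i dotrV mr (coord v i w *: v`_i)| <= S * B.
  apply: (le_trans (ler_norm_sum _ _ _)); rewrite mulr_suml.
  apply: ler_sum => i _; rewrite dotrV_scaler normrM ler_wpM2l//.
  by rewrite -tnth_nth.
move=> /(le_trans cw); rewrite leNgt => /negP; apply.
have -> : c * N%:R `^ (- s) = (1 + S) * B by rewrite /B; field; rewrite gt_eqF// ltr_pwDl.
by rewrite ltr_pM2r// ltrDr.
Qed.

End discrepancy.

(** * The span and the torus *)

Section span.
Context {R : realType} {k d : nat} (v : d.-tuple 'rV[R]_k).

Lemma torus_pi_box (a b : 'rV[R]_k) :
  @torus_pi R k @^-1` (@torus_pi R k @` [set x : 'rV[R]_k | forall i, a 0 i <= x 0 i <= b 0 i]) =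
  modZ_box a b.
Proof.
apply/seteqP; split => [p [x xab]|p pab].
  move=> /eqP; rewrite /torus_pi -Quotient.idealrBE unfold_in => /forallP xp i.
  have /intrP[n] := xp i; rewrite !mxE => xpn; exists n.
  by rewrite (_ : p 0 i + n%:~R = x 0 i) ?xab// -xpn; ring.
have [n pn] := choice pab.
exists (p + \row_i (n i)%:~R) => [i|]; first by rewrite !mxE.
apply/eqP; rewrite /torus_pi -Quotient.idealrBE unfold_in; apply/forallP => i.
by rewrite !mxE addrAC subrr add0r; exact: intr_int.
Qed.

Hypothesis vfree : free v.

Lemma coord_lincomb i (a : 'rV[R]_d) : coord v i (lincomb v a) = a 0 i.
Proof.
rewrite /lincomb (eq_bigr (fun i => a 0 i *: v`_i)); first exact: coord_sum_free.
by move=> j _; rewrite (tnth_nth 0).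
Qed.

Lemma preimage_span_box T : lincomb v @^-1` span_box v T = cube T.
Proof.
apply/seteqP; split => [a [b bT] /(congr1 (fun t => coord v ^~ t)) ba i|a aT].
  have := congr1 (@^~ i) ba; rewrite /= !coord_lincomb => <-.
  by rewrite /= in_itv/= -ler_norml; exact: bT.
by exists a => // i; have := aT i; rewrite /= in_itv/= -ler_norml.
Qed.

(** The coordinate forms extend linearly, hence measurably, to the whole space; the span box
    consists of the points with coordinates in the cube that equal the combination of those
    coordinates. *)
Lemma measurable_span_box T : measurable (span_box v T).
Proof.
pose crd (t : 'rV[R]_k) : 'rV[R]_d := \row_i coord v i t.
have mcrd : measurable_fun setT crd.
  apply: measurable_fun_coordP => i.
  rewrite (_ : (fun t => _) = fun t : 'rV[R]_k => \sum_j t 0 j * coord v i (delta_mx 0 j)).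
    apply: measurable_sum => j; apply: measurable_funM => //.
    exact: measurable_coord.
  apply/funext => t; rewrite mxE {1}(row_sum_delta t) linear_sum.
  by apply: eq_bigr => j _; rewrite linearZ.
rewrite (_ : span_box v T = crd @^-1` cube T `&`
    (fun t : 'rV[R]_k => t - lincomb v (crd t)) @^-1` rV_box (fun=> [set 0])).
  apply: measurableI.
    rewrite -[X in measurable X]setTI; apply: mcrd => //; exact: measurable_cube.
  rewrite -[X in measurable X]setTI.
  suff h : measurable_fun setT (fun t : 'rV[R]_k => t - lincomb v (crd t)).
    by apply: h => //; apply: measurable_rV_box => i; exact: measurable_set1.
  apply: measurable_fun_coordP => i; under eq_fun do rewrite !mxE.
  apply: measurable_funB; first exact: measurable_coord.
  apply: (measurableT_comp (measurable_coord i)).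
  exact: (measurableT_comp (measurable_lincomb v)).
apply/seteqP; split => [t [a aT <-]|t [tT t0]].
  have E : crd (lincomb v a) = a by apply/rowP => i; rewrite mxE coord_lincomb.
  split => i; rewrite E; last by rewrite /= subrr mxE.
  by rewrite /= in_itv/= -ler_norml; exact: aT.
exists (crd t); first by move=> i; have := tT i; rewrite /= in_itv/= -ler_norml.
by apply/esym/eqP; rewrite -subr_eq0; apply/eqP/rowP => i; rewrite [LHS]t0 mxE.
Qed.

Lemma span_lebesgue_box T : 0 <= T ->
  span_lebesgue v (span_box v T) = (Num.sqrt (\det (gram v)) * (2 * T) ^+ d)%:E.
Proof.
by move=> T0; rewrite /span_lebesgue /pushforward preimage_span_box lebesgue_cube// EFinM.
Qed.

(** Change of variables along [lincomb]: the integral passes to the coefficients, and the Jacobian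
    comes out as a scalar. *)
Lemma visits_cube (U : set (torus R k)) (x : 'rV[R]_k) (T : R) :
  measurable (@torus_pi R k @^-1` U) ->
  visits v U x T = ((Num.sqrt (\det (gram v)))%:E *
    \int[lebesgue_rV d]_(a in cube T) (\1_(@torus_pi R k @^-1` U) (x + lincomb v a))%:E)%E.
Proof.
move=> mU; pose s : {nonneg R} := NngNum (sqrtr_ge0 (\det (gram v))).
pose pl := measure_function_pushforward__canonical__measure_function_Measure
  (lebesgue_rV d) (measurable_lincomb v).
have mS := measurable_span_box T.
have mf : measurable_fun (span_box v T) (fun t : 'rV[R]_k => (\1_U (torus_pi (x + t)) : R)%:E).
  apply/measurable_EFinP; apply: measurable_funTS.
  suff mxt : measurable_fun setT (fun t : 'rV[R]_k => x + t).
    exact: (measurableT_comp (measurable_indic mU) mxt).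
  apply: measurable_fun_coordP => i; under eq_fun do rewrite mxE.
  by apply: measurable_funD => //; exact: measurable_coord.
rewrite /visits (@eq_measure_integral _ _ _ _ (mscale s pl))//.
rewrite ge0_integral_mscale//; congr (_ * _)%E.
rewrite [LHS](@ge0_integral_pushforward _ _ _ _ _ _ (measurable_lincomb v))//.
  by rewrite preimage_span_box.
Qed.

End span.

(** * Choice of the parameters *)

Section rate.
Context {R : realType}.

(* With Y = T^delta and N <= 2 Y^3, the identity for T makes N^k N^s / T
   at most a constant times Y^-3. *)
Lemma powR_rate (T s : R) (k : nat) : 1 < T -> 0 < s ->
  let Y := T `^ (3 * (k%:R + s + 1))^-1 in
  1 <= Y /\ T = Y ^+ (3 * k) * (Y ^+ 3) `^ s * Y ^+ 3.
Proof.
move=> T1 s0 Y; have T0 : 0 < T by lra.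
have ks0 : 0 < 3 * (k%:R + s + 1) by have := ler0n R k; lra.
have Y1 : 1 <= Y.
  have <- : 1 `^ (3 * (k%:R + s + 1))^-1 = 1 :> R by rewrite powR1.
  by rewrite ge0_ler_powR ?nnegrE ?invr_ge0// ltW.
split => //; have Y0 : 0 < Y by lra.
rewrite -{1}(powRr1 (ltW T0)) -(mulVf (lt0r_neq0 ks0)) powRrM -/Y.
rewrite (_ : 3 * _ = (3 * k)%:R + 3 * s + 3%:R); last by rewrite natrM; ring.
rewrite powRD ?(gt_eqF Y0) ?implybT// [Y `^ (_ + 3 * s)]powRD ?(gt_eqF Y0) ?implybT//.
by rewrite [Y `^ (3 * s)]powRrM !powR_mulrn ?(ltW Y0).
Qed.

End rate.

Section equidistribution.
Context {R : realType} {k d : nat} (v : d.-tuple 'rV[R]_k).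

(** With [N] of order [Y ^ 3] and [e] of order [1 / Y], the collar term and the Chebyshev term are
    both of order [T ^ d / Y], and the choice of [Y] makes the oscillatory term no larger in
    order. *)
Lemma modZ_box_equidistribution (V : {vspace 'rV[R]_k}) : (0 < d)%N -> basis_of V v ->
  diophantine_subspace V -> exists C delta : R, [/\ 0 < C, 0 < delta &
    forall (a b x : 'rV[R]_k) (T : R), 1 < T -> exists I r : R,
    [/\ (\int[lebesgue_rV d]_(t in cube T) (\1_(modZ_box a b) (x + lincomb v t))%:E)%E = I%:E,
        lebesgue_rV k (modZ_box a b `&` unit_box) = r%:E &
        `|I - r * (2 * T) ^+ d| <= C * T `^ (d%:R - delta)]].
Proof.
move=> d0 vV /(diophantine_basis vV)[c [s [c0 s0 cs]]].
(* The three summands are the constants of [t1], [t2] and [t3] below, in this order. *)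
pose C := 2 ^+ d * (k%:R / 2 + 2 * 2 ^+ k * 2 `^ s / c + 4 * k%:R).
exists (C + 1), (3 * (k%:R + s + 1))^-1.
have C0 : 0 <= C.
  by rewrite mulr_ge0// !addr_ge0// ?divr_ge0 ?mulr_ge0 ?powR_ge0 ?(ltW c0).
split; [lra|by rewrite invr_gt0; have := ler0n R k; lra|move=> a b x T T1].
have T0 : 0 < T by lra.
have [Y1 TY] := powR_rate k T1 s0; set Y := T `^ _ in Y1 TY.
have Y0 : 0 < Y by lra.
have Y3 : 1 <= Y ^+ 3 by rewrite exprn_ege1.
pose N := (Num.truncn (Y ^+ 3)).+1.
have /andP[N2 N1] : (Num.truncn (Y ^+ 3))%:R <= Y ^+ 3 < N%:R.
  by apply: truncn_itv; lra.
have {}N2 : N%:R <= 2 * Y ^+ 3 by rewrite /N -natr1; lra.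
have Npos : (0 : R) < N%:R by lra.
have Ns0 : 0 < N%:R `^ s by rewrite powR_gt0.
(* This is 2 divided by the Diophantine lower bound [c * N ^ (-s)]. *)
pose M := 2 * N%:R `^ s / c.
have M0 : 0 <= M by rewrite divr_ge0 ?mulr_ge0 ?(ltW c0) ?(ltW Ns0).
have vM : nonresonant v N M.
  move=> m m0 mN; have [i ci] := cs m m0 N isT mN; exists i.
  have cN : 0 < c * N%:R `^ (- s) by rewrite mulr_gt0// powR_gt0.
  have v0 : 0 < `|dotrV (freq m) (tnth v i)| by exact: lt_le_trans ci.
  split; first by rewrite -normr_gt0.
  rewrite ler_pdivrMr// /M; move: ci; rewrite powRN ler_pdivrMr// => ci.
  by rewrite mulrAC ler_pdivlMr//; lra.
(* The factor 4 ensures [e <= 1/4], since [1 <= Y]. *)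
pose e := (4 * Y)^-1.
have e01 : 0 < e <= 4^-1.
  by rewrite /e invr_gt0 mulr_gt0//= lef_pV2 ?posrE ?mulr_gt0//; lra.
have [I [r [IE rE Ir]]] := modZ_box_discrepancy a b x (isT : (0 < N)%N) e01 T0 M0 vM.
exists I, r; split => //; apply: (le_trans Ir).
have Td0 : 0 < (2 * T) ^+ d by rewrite exprn_gt0// mulr_gt0.
have -> : T `^ (d%:R - (3 * (k%:R + s + 1))^-1) = T ^+ d / Y.
  by rewrite powRB ?(gt_eqF T0) ?implybT// powR_mulrn// ltW.
have t1 : k%:R * (2 * e) * (2 * T) ^+ d = 2 ^+ d * (k%:R / 2) * (T ^+ d / Y).
  by rewrite /e exprMn; field; rewrite gt_eqF.
have t3 : (2 * T) ^+ d * (k%:R / (2 * N%:R * (2 * e ^+ 2))) <=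
    2 ^+ d * (4 * k%:R) * (T ^+ d / Y).
  rewrite (_ : _ * _ = 2 ^+ d * (4 * k%:R) * T ^+ d * (Y ^+ 2 / N%:R)); last first.
    by rewrite /e exprMn; field; rewrite !gt_eqF.
  rewrite [leRHS]mulrA ler_wpM2l ?mulr_ge0 ?exprn_ge0 ?(ltW T0)//.
  by rewrite ler_pdivrMr// ler_pdivlMl// -exprS ltW.
have t2 : N%:R ^+ k * (2 * T) ^+ d.-1 * M <=
    2 ^+ d * (2 * 2 ^+ k * 2 `^ s / c) * (T ^+ d / Y).
  have Nk : N%:R ^+ k <= 2 ^+ k * Y ^+ (3 * k) :> R.
    by rewrite exprM -exprMn lerXn2r ?nnegrE ?mulr_ge0 ?exprn_ge0 ?(ltW Y0).
  have Ns : N%:R `^ s <= 2 `^ s * (Y ^+ 3) `^ s.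
    rewrite -powRM ?exprn_ge0 ?(ltW Y0)//.
    by rewrite ge0_ler_powR ?nnegrE ?mulr_ge0 ?exprn_ge0 ?(ltW Y0) ?(ltW s0).
  have NNT : N%:R ^+ k * N%:R `^ s <= 2 ^+ k * 2 `^ s * (T / Y).
    apply: (@le_trans _ _ (2 ^+ k * Y ^+ (3 * k) * (2 `^ s * (Y ^+ 3) `^ s))).
      by rewrite ler_pM ?exprn_ge0 ?(ltW Ns0).
    rewrite mulrACA ler_wpM2l ?mulr_ge0 ?exprn_ge0 ?powR_ge0//.
    rewrite ler_pdivlMr// [in leRHS]TY ler_wpM2l ?mulr_ge0 ?exprn_ge0 ?powR_ge0 ?(ltW Y0)//.
    by rewrite exprS ler_peMr ?(ltW Y0)// exprn_ege1.
  rewrite (_ : _ * M = (N%:R ^+ k * N%:R `^ s) * ((2 * T) ^+ d.-1 * (2 / c))); last first.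
    by rewrite /M; ring.
  apply: (@le_trans _ _ (2 ^+ k * 2 `^ s * (T / Y) * ((2 * T) ^+ d.-1 * (2 / c)))).
    by rewrite ler_wpM2r// mulr_ge0 ?exprn_ge0 ?divr_ge0 ?mulr_ge0 ?(ltW T0) ?(ltW c0).
  (* As [d] is positive, the factor [T] from [NNT] restores the power lost in the nonresonant
     direction. *)
  have Td : T ^+ d = T * T ^+ d.-1 by rewrite -exprS prednK.
  have dd : 2 ^+ d.-1 <= 2 ^+ d :> R by rewrite ler_eXn2l ?leq_pred//; lra.
  rewrite (_ : _ * _ = 2 ^+ d.-1 * (2 * 2 ^+ k * 2 `^ s / c) * (T ^+ d / Y)); last first.
    by rewrite Td exprMn; field; rewrite !gt_eqF.
  rewrite -!mulrA ler_wpM2r// !mulr_ge0 ?exprn_ge0 ?powR_ge0 ?invr_ge0 ?(ltW T0) ?(ltW c0) ?(ltW Y0)//.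
have TY0 : 0 <= T ^+ d / Y by rewrite divr_ge0 ?exprn_ge0 ?ltW.
rewrite t1 /C; lra.
Qed.

End equidistribution.

Theorem theorem1p3 (R : realType) (k d : nat) (V : {vspace 'rV[R]_k})
    (v : d.-tuple 'rV[R]_k) (d_bounds : (1 <= d < k)%N) (vV : basis_of V v)
    (dioV : diophantine_subspace V) :
  exists C delta : R, [/\ 0 < C, 0 < delta &
    forall (x : 'rV[R]_k) (T : R) (U : set (torus R k)),
      1 < T -> aligned_box U ->
      (`| visits v U x T - torus_lebesgue U * span_lebesgue v (span_box v T) |
         <= (C * T `^ (d%:R - delta))%:E)%E].
Proof.
have /andP[d0 _] := d_bounds; have vfree := basis_free vV.
have [C [delta [C0 delta0 H]]] := modZ_box_equidistribution d0 vV dioV.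
pose s := Num.sqrt (\det (gram v)); have s0 : 0 <= s by exact: sqrtr_ge0.
(* The Jacobian [s] multiplies the whole discrepancy; adding 1 makes positivity of the constant
   immediate from [0 <= s]. *)
exists (s * C + 1), delta; split => //; first by rewrite ltr_wpDl ?mulr_ge0// ltW.
move=> x T U T1 [a [b [_ UE]]]; have T0 : 0 <= T by lra.
have UW : @torus_pi R k @^-1` U = modZ_box a b by rewrite UE torus_pi_box.
have [I [r [IE rE Ir]]] := H a b x T T1.
have tU : torus_lebesgue U = r%:E.
  by rewrite /torus_lebesgue UW -rE; congr (lebesgue_rV k (_ `&` _)).
rewrite visits_cube ?UW//; last exact: measurable_modZ_box.
rewrite IE tU span_lebesgue_box// -/s -!EFinM -EFinB lee_fin.
rewrite (_ : _ - _ = s * (I - r * (2 * T) ^+ d)); last by ring.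
rewrite normrM ger0_norm// [leRHS]mulrDl mul1r ler_wpDr ?powR_ge0//.
by rewrite -mulrA ler_wpM2l.
Qed.
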